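(* Let $n\ge1$ and let $(Q,\sigma)$ be the equioriented symmetric quiver of type $A_{2n}$: vertices $1,\dots,2n$, arrows $a_i:i\to i+1$ ($1\le i\le 2n-1$), $\sigma(i)=2n+1-i$, $\sigma(a_i)=a_{2n-i}$. Let $\alpha$ be a symmetric dimension vector written $(\alpha_1,\dots,\alpha_n)$ with $\alpha_i=\alpha_{2n+1-i}$, and for $V\in ORep(Q,\alpha)$ write $V(a_i)$ for the maps of the corresponding orthogonal representation (so $V(a_n):V_n\to V_n^*$ is skew-symmetric and $V(a_{2n-i})=-V(a_i)^t$). Then $OSI(Q,\alpha)$ is generated by the following semi-invariants: (i) $\det(V(a_i)\cdots V(a_j))$ for $1\le j\le i\le n-1$ such that $\alpha_j=\alpha_{i+1}<\min\{\alpha_{j+1},\dots,\alpha_i\}$ (vacuous minimum condition when $i=j$); (ii) $\mathrm{pf}(V(a_{2n-i})\cdots V(a_i))$ (Pfaffian of the skew-symmetric map $V_i\to V_i^*$) for $1\le i\le n$ such that $\alpha_i<\min\{\alpha_{i+1},\dots,\alpha_n\}$ (vacuous when $i=n$) and $\alpha_i$ is even.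
   Context: $\mathbb{K}$ is algebraically closed of characteristic 0. Here $Q_0^+=\{1,\dots,n\}$, $Q_1^+=\{a_1,\dots,a_{n-1}\}$, $Q_1^\sigma=\{a_n\}$, $ORep(Q,\alpha)=\bigoplus_{i=1}^{n-1}\mathrm{Hom}(\mathbb{K}^{\alpha_i},\mathbb{K}^{\alpha_{i+1}})\oplus\bigwedge^2(\mathbb{K}^{\alpha_n})^*$, with the action of $SO(Q,\alpha)=\prod_{i=1}^n SL(\alpha_i)$ by $g\cdot V=(g_{ha}V(a)g_{ta}^{-1})$, $g_{\sigma(x)}:=(g_x^{-1})^t$; $OSI(Q,\alpha)=\mathbb{K}[ORep(Q,\alpha)]^{SO(Q,\alpha)}$. $\mathrm{pf}$ denotes the Pfaffian, $\mathrm{pf}(A)^2=\det A$. *)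

(* Defs.v *)
From HB Require Import structures.
From mathcomp Require Import all_boot all_order all_algebra.
From mathcomp Require Import fingroup perm.
Set Implicit Arguments. Unset Strict Implicit. Unset Printing Implicit Defensive.
Import Order.TTheory GRing.Theory Num.Theory.
Local Open Scope ring_scope.

(* determinant of a matrix whose two dimensions are (propositionally)
   equal; 0 otherwise (only used when the dimensions agree). *)
Definition rdet (R : comNzRingType) m n (A : 'M[R]_(m, n)) : R :=
  match m =P n with
  | ReflectT e => \det (castmx (erefl m, esym e) A)
  | ReflectF _ => 0
  end.

Definition mxat (R : nzRingType) m (A : 'M[R]_m) (a b : nat) : R :=
  match insub a, insub b with
  | Some x, Some y => A x y
  | _, _ => 0
  end.

Definition permat m (s : 'S_m) (a : nat) : nat :=
  match insub a with Some x => (s x : nat) | None => a end.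

(* Pfaffian of an m x m matrix (m = 2k):
   pf A = 1/(2^k k!) * sum_{s in S_{2k}} sgn(s) prod_{i<k} A_{s(2i), s(2i+1)};
   0 when m is odd. Satisfies pf(A)^2 = det A for skew-symmetric A. *)
Definition pfaffian (F : fieldType) m (A : 'M[F]_m) : F :=
  if odd m then 0 else
  ((2 ^ m./2 * m./2`!)%:R)^-1 *
  \sum_(s : 'S_m) (-1) ^+ s *
     \prod_(i < m./2) mxat A (permat s (i : nat).*2) (permat s (i : nat).*2.+1).

(* Vertices 1..2n, arrows a_k : k -> k+1, sigma(k) = 2n+1-k.          *)
(* alpha : nat -> nat gives alpha_1, ..., alpha_n (values at 1..n      *)
(* only are relevant), alpha_{2n+1-k} = alpha_k.                      *)
(* ORep(Q,alpha) = (+)_{k=1}^{n-1} Hom(K^alpha_k, K^alpha_{k+1})        *)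
(*                 (+) Lambda^2 (K^alpha_n)^*                          *)
(* Linear maps are matrices acting on column vectors; the arrow       *)
(* a_{k+1} (k : 'I_(n-1), 0-based) is a matrix of size                *)
(* alpha_{k+2} x alpha_{k+1}; V(a_n) : V_n -> V_n^* is a skew-symmetric*)
(* alpha_n x alpha_n matrix.                                          *)

Record orep (K : fieldType) (n : nat) (alpha : nat -> nat) := ORep {
  omap : forall k : 'I_n.-1, 'M[K]_(alpha k.+2, alpha k.+1);
  oskew : 'M[K]_(alpha n);
  oskewP : oskew^T = - oskew
}.

(* V(a_k) for 1 <= k <= n-1 (0 outside this range) *)
Definition arr (K : fieldType) n alpha (V : orep K n alpha) (k : nat)
  : 'M[K]_(alpha k.+1, alpha k) :=
  match k with
  | 0 => 0
  | k'.+1 =>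
    (if (k' < n.-1)%N as b return (k' < n.-1)%N = b -> 'M[K]_(alpha k'.+2, alpha k'.+1)
     then fun h => omap V (Ordinal h) else fun _ => 0) (erefl _)
  end.

Fixpoint chain (K : fieldType) n alpha (V : orep K n alpha) (j d : nat)
  : 'M[K]_(alpha (d + j).+1, alpha j) :=
  match d with
  | 0 => arr V j
  | d'.+1 => arr V (d'.+1 + j) *m chain V j d'
  end.

(* The composite V(a_{2n-i}) ... V(a_n) ... V(a_i) : V_i -> V_i^*, for
   1 <= i <= n, written out using V(a_{2n-k}) = - V(a_k)^T:
   it equals (-1)^(n-i) C^T V(a_n) C with C = V(a_{n-1}) ... V(a_i)
   (C = identity when i = n). *)
Definition skew_comp (K : fieldType) n alpha (V : orep K n alpha) (i : nat)
  : 'M[K]_(alpha i) :=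
  match n =P (n - i - 1 + i).+1 with
  | ReflectT e =>
      let C : 'M[K]_(alpha n, alpha i) :=
        castmx (congr1 alpha (esym e), erefl) (chain V i (n - i - 1)) in
      (-1) ^+ (n - i) *: (C^T *m oskew V *m C)
  | ReflectF _ =>
      match i =P n with
      | ReflectT e => castmx (congr1 alpha (esym e), congr1 alpha (esym e)) (oskew V)
      | ReflectF _ => 0
      end
  end.

Definition SOelt (K : fieldType) n alpha (g : forall k : 'I_n, 'M[K]_(alpha k.+1)) :=
  forall k, \det (g k) = 1.

(* g_v for vertex 1 <= v <= n (identity otherwise) *)
Definition gat (K : fieldType) n alpha (g : forall k : 'I_n, 'M[K]_(alpha k.+1))
  (v : nat) : 'M[K]_(alpha v) :=
  match v with
  | 0 => 1%:M
  | v'.+1 =>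
    (if (v' < n)%N as b return (v' < n)%N = b -> 'M[K]_(alpha v'.+1)
     then fun h => g (Ordinal h) else fun _ => 1%:M) (erefl _)
  end.

Lemma act_skewP (K : fieldType) m (h S : 'M[K]_m) :
  S^T = - S -> (h^T *m S *m h)^T = - (h^T *m S *m h).
Proof. by move=> hS; rewrite !trmx_mul trmxK hS mulNmx mulmxN mulmxA. Qed.

(* g . V : V(a_k) |-> g_{k+1} V(a_k) g_k^{-1} (k <= n-1),
           V(a_n) |-> (g_n^{-1})^T V(a_n) g_n^{-1}
   (since g_{sigma(n)} = g_{n+1} = (g_n^{-1})^T). *)
Definition oact (K : fieldType) n alpha (g : forall k : 'I_n, 'M[K]_(alpha k.+1))
  (V : orep K n alpha) : orep K n alpha :=
  @ORep K n alpha
    (fun k => gat g (k : nat).+2 *m omap V k *m invmx (gat g (k : nat).+1))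
    ((invmx (gat g n))^T *m oskew V *m invmx (gat g n))
    (act_skewP (invmx (gat g n)) (oskewP V)).

Inductive polyfun (K : fieldType) n alpha : (orep K n alpha -> K) -> Prop :=
  | pf_const c : polyfun (fun _ => c)
  | pf_coord_map k r c : polyfun (fun V => omap V k r c)
  | pf_coord_skew r c : polyfun (fun V => oskew V r c)
  | pf_add f g : polyfun f -> polyfun g -> polyfun (fun V => f V + g V)
  | pf_mul f g : polyfun f -> polyfun g -> polyfun (fun V => f V * g V)
  | pf_ext f g : polyfun f -> (forall V, f V = g V) -> polyfun g.

Definition in_OSI (K : fieldType) n alpha (f : orep K n alpha -> K) : Prop :=
  polyfun f /\
  forall g, SOelt g -> forall V, f (oact g V) = f V.

Inductive gen_alg (K : fieldType) (T : Type) (S : (T -> K) -> Prop)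
  : (T -> K) -> Prop :=
  | alg_const c : gen_alg S (fun _ => c)
  | alg_gen f : S f -> gen_alg S f
  | alg_add f g : gen_alg S f -> gen_alg S g -> gen_alg S (fun x => f x + g x)
  | alg_mul f g : gen_alg S f -> gen_alg S g -> gen_alg S (fun x => f x * g x)
  | alg_ext f g : gen_alg S f -> (forall x, f x = g x) -> gen_alg S g.

Definition det_gen (K : fieldType) n alpha (f : orep K n alpha -> K) : Prop :=
  exists i j : nat,
    [/\ (1 <= j <= i)%N, (i <= n.-1)%N,
        alpha j = alpha i.+1,
        (forall k, (j < k)%N -> (k <= i)%N -> (alpha j < alpha k)%N) &
        f = fun V => rdet (chain V j (i - j))].

Definition pf_gen (K : fieldType) n alpha (f : orep K n alpha -> K) : Prop :=
  exists i : nat,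
    [/\ (1 <= i)%N, (i <= n)%N,
        (forall k, (i < k)%N -> (k <= n)%N -> (alpha i < alpha k)%N),
        ~~ odd (alpha i) &
        f = fun V => pfaffian (skew_comp V i)].

Definition OSI_gens (K : fieldType) n alpha (f : orep K n alpha -> K) : Prop :=
  det_gen f \/ pf_gen f.

(* Main.v *)
(* The semi-invariants are computed by a section of the generic orbits. Let [phi (t, tau)] be
   the representation whose arrows are partial identity matrices, with the last diagonal entry
   of an arrow replaced by a parameter [t k] when a determinant in (i) ends at that arrow, and
   whose skew form is a skew companion matrix with leading Pfaffians [tau r], free when a
   Pfaffian in (ii) has size [2 (r + 1)] and equal to 1 otherwise. The generators in (i) and
   (ii) take on [phi (t, tau)] the values [t] and [tau] (up to nonzero constants), so for a
   polynomial invariant [f] the function [V |-> f (phi (generators of V))] is a polynomial in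
   the generators that agrees with [f] on the image of [phi].

   It remains to see that an invariant [F] vanishing on the image of [phi] vanishes. The
   arrows are normalised from left to right: once the first [k] arrows are in normal form, the
   subgroup of [SL(alpha_(k+1))] that extends to their stabiliser contains the upper triangular
   matrices that preserve the volume of the flags in [Dk k], and together with
   [SL(alpha_(k+2))] it brings a generic next arrow to normal form. Genericity is removed by
   restricting [F] to a line through a generic point, where it is a polynomial in one
   variable. *)

Require Import Defs.
From HB Require Import structures.
From mathcomp Require Import all_boot all_order all_algebra.
From mathcomp Require Import fingroup perm zify ring.
Set Implicit Arguments. Unset Strict Implicit. Unset Printing Implicit Defensive.
Import GRing.Theory.
Local Open Scope ring_scope.

(** * Pfaffians *)

Lemma dbl_lt0 k (i : 'I_k) : ((i : nat).*2 < k.*2)%N.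
Proof. by rewrite ltn_double. Qed.

Lemma dbl_lt1 k (i : 'I_k) : ((i : nat).*2.+1 < k.*2)%N.
Proof. by have := ltn_ord i; lia. Qed.

Definition pr0 k (i : 'I_k) : 'I_k.*2 := Ordinal (dbl_lt0 i).
Definition pr1 k (i : 'I_k) : 'I_k.*2 := Ordinal (dbl_lt1 i).

Lemma half_lt k (x : 'I_k.*2) : ((x : nat)./2 < k)%N.
Proof. by have := ltn_ord x; lia. Qed.

Definition hf k (x : 'I_k.*2) : 'I_k := Ordinal (half_lt x).

Lemma hf_pr0 k (i : 'I_k) : hf (pr0 i) = i.
Proof. by apply: val_inj => /=; lia. Qed.

Lemma hf_pr1 k (i : 'I_k) : hf (pr1 i) = i.
Proof. by apply: val_inj => /=; lia. Qed.

Lemma pr_hf k (x : 'I_k.*2) : x = if odd x then pr1 (hf x) else pr0 (hf x).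
Proof. by apply: val_inj; case: ifP => /=; lia. Qed.

Lemma prod_pairs (R : comNzRingType) k (f : 'I_k.*2 -> R) :
  \prod_x f x = \prod_(i < k) (f (pr0 i) * f (pr1 i)).
Proof.
elim: k f => [|k IH] f; first by rewrite !big_ord0.
rewrite [LHS](@big_ord_recr _ _ _ k.*2.+1) [in LHS](@big_ord_recr _ _ _ k.*2).
rewrite IH big_ord_recr /= -mulrA; congr (_ * (_ * _)).
- by apply: eq_bigr => i _; congr (f _ * f _); apply: val_inj.
- by congr f; apply: val_inj.
- by congr f; apply: val_inj.
Qed.

(** A fixed even size [k.*2] makes the pairs total functions [pr0], [pr1], and leaving out the
    normalising factor allows any commutative ring. *)
Definition pfterm (R : comNzRingType) k (A : 'M[R]_k.*2) (s : 'S_k.*2) : R :=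
  (-1) ^+ s * \prod_(i < k) A (s (pr0 i)) (s (pr1 i)).

Lemma mxat_permat (R : nzRingType) m (A : 'M[R]_m) (s : 'S_m) (x y : 'I_m) :
  mxat A (permat s x) (permat s y) = A (s x) (s y).
Proof. by rewrite /mxat /permat !valK. Qed.

Lemma pfaffianE (F : fieldType) k (A : 'M[F]_k.*2) :
  pfaffian A = ((2 ^ k * k`!)%:R)^-1 * \sum_s pfterm A s.
Proof.
rewrite /pfaffian odd_double doubleK; congr (_ * _); apply: eq_bigr => s _.
congr (_ * _); apply: eq_bigr => i _.
exact: (mxat_permat A s (pr0 i) (pr1 i)).
Qed.

(** As for the multiplicativity of the determinant: expanding gives a sum over all self-maps [f] of
    the index set of a product of entries of [A] times the determinant of the rows of [B] chosen by
    [f]. A non-injective [f] repeats a row and contributes 0. *)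
Lemma pfsum_congr (R : comNzRingType) k (A B : 'M[R]_k.*2) :
  \sum_s pfterm (B^T *m A *m B) s = \det B * \sum_s pfterm A s.
Proof.
pose m := k.*2.
pose F := {ffun 'I_m -> 'I_m}.
pose P (f : F) := \prod_(i < k) A (f (pr0 i)) (f (pr1 i)).
transitivity (\sum_(f : F) \sum_(s : 'S_m)
                P f * ((-1) ^+ s * \prod_x B (f x) (s x))).
  rewrite exchange_big /=; apply: eq_bigr => s _.
  under [RHS]eq_bigr do rewrite mulrCA.
  rewrite -big_distrr /=; congr (_ * _).
  transitivity (\prod_(i < k) \sum_(p : 'I_m * 'I_m)
     A p.1 p.2 * (B p.1 (s (pr0 i)) * B p.2 (s (pr1 i)))).
    apply: eq_bigr => i _; rewrite mxE.
    under eq_bigr do rewrite mxE big_distrl /=.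
    rewrite exchange_big /= (pair_big xpredT xpredT) /=.
    by apply: eq_bigr => -[a b] _ /=; rewrite mxE; ring.
  rewrite bigA_distr_bigA /=.
  (* A self-map of the [2k] indices amounts to [k] pairs of indices. *)
  rewrite (reindex (fun f : F => [ffun i => (f (pr0 i), f (pr1 i))])) /=; last first.
    exists (fun g : {ffun 'I_k -> 'I_m * 'I_m} =>
       [ffun x : 'I_m => if odd x then (g (hf x)).2 else (g (hf x)).1]) => g _.
      apply/ffunP => x; rewrite !ffunE [in RHS](pr_hf x) /=.
      by case: ifP.
    apply/ffunP => i; rewrite !ffunE /= odd_double /= hf_pr0 hf_pr1.
    by case: (g i).
  apply: eq_bigr => f _; rewrite prod_pairs -big_split /=.
  by apply: eq_bigr => i _; rewrite ffunE.
under eq_bigr do rewrite -big_distrr /=.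
rewrite (bigID (fun f : F => injectiveb f)) /= addrC big1 ?add0r => [|f Uf].
  rewrite (reindex (@pval _)) /=; last first.
    pose in_Sn := insubd (1%g : 'S_m).
    by exists in_Sn => /= f Uf; first apply: val_inj; apply: insubdK.
  rewrite big_distrr /=.
  apply: eq_big => /= [s | s _]; rewrite ?(valP s) //.
  (* For a bijective [f = s], writing the second permutation as [s * t] splits off the sign of [s]
     and leaves the expansion of [\det B]. *)
  rewrite (reindex_inj (mulgI s)) /= /pfterm /P.
  under [X in _ * X]eq_bigr => t _.
    rewrite odd_permM signr_addb -mulrA.
    under eq_bigr => x _ do rewrite pvalE permM.
    have -> : \prod_x B (s x) (t (s x)) = \prod_y B y (t y).
      by rewrite [RHS](reindex_perm s).
    over.
  rewrite -big_distrr /= -/(\det B) mulrA mulrC; congr (_ * _).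
  rewrite mulrC; congr (_ * _).
  by apply: eq_bigr => i _; rewrite !pvalE.
transitivity (P f * \det (\matrix_(i, j) B (f i) j)).
  congr (_ * _); apply: eq_bigr => s _; congr (_ * _).
  by apply: eq_bigr => x _; rewrite mxE.
case/injectivePn: Uf => i1 [i2 Di12 Ef12].
by rewrite (determinant_alternate Di12) ?mulr0 //= => j; rewrite !mxE Ef12.
Qed.

Lemma pfaffian_congr (F : fieldType) m (A B : 'M[F]_m) :
  pfaffian (B^T *m A *m B) = \det B * pfaffian A.
Proof.
case om: (odd m); first by rewrite /pfaffian om mulr0.
have em : m = m./2.*2 by lia.
move: (m./2) em => k em; move: A B; rewrite em => A B.
by rewrite !pfaffianE pfsum_congr mulrCA.
Qed.

(** The transposition changes the sign of the permutation and, by skewness, that of the factor at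
    [i]; the two changes cancel. *)
Lemma pfterm_tperm (R : comNzRingType) k (A : 'M[R]_k.*2) (s : 'S_k.*2) (i : 'I_k) :
  A^T = - A -> pfterm A (tperm (pr0 i) (pr1 i) * s)%g = pfterm A s.
Proof.
move=> skA; rewrite /pfterm odd_permM odd_tperm.
have -> : pr0 i != pr1 i by rewrite -val_eqE /=; lia.
rewrite signr_addb expr1 -mulrA mulrCA; congr (_ * _).
rewrite (bigD1 i) //= [in RHS](bigD1 i) //= mulrA; congr (_ * _).
  rewrite !permM tpermL tpermR mulN1r.
  by move/matrixP: skA => /(_ (s (pr0 i)) (s (pr1 i))); rewrite !mxE => ->; rewrite opprK.
apply: eq_bigr => j ji; rewrite !permM !tpermD // -val_eqE /=;
  move: ji; rewrite -val_eqE /=; lia.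
Qed.

Definition swp k (x : 'I_k.*2) : 'I_k.*2 := if odd x then pr0 (hf x) else pr1 (hf x).

Lemma swpK k : involutive (@swp k).
Proof.
move=> x; rewrite [RHS]pr_hf /swp; case: (odd x) => /=;
  by rewrite odd_double ?hf_pr0 ?hf_pr1.
Qed.

Lemma odd_swp k (x : 'I_k.*2) : odd (swp x) = ~~ odd x.
Proof. by rewrite /swp; case: (odd x) => /=; rewrite odd_double. Qed.

(* Such an [s] acts on the even indices as on the odd ones, so its sign is a square. *)
Lemma odd_perm_pairs k (s : 'S_k.*2) :
  (forall i, ~~ odd (s (pr0 i))) -> (forall i, s (pr1 i) = swp (s (pr0 i))) ->
  odd_perm s = false.
Proof.
move=> s0 s1.
have par x : odd (s x) = odd x.
  rewrite [in LHS](pr_hf x); case: (odd x); last exact/negbTE.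
  by rewrite s1 odd_swp s0.
have sw x : s (swp x) = swp (s x).
  rewrite [in RHS](pr_hf x) {1}/swp; case: (odd x); last by rewrite s1.
  by rewrite s1 swpK.
have injE (b : bool) : injective (fun x : 'I_k.*2 => if odd x == b then x else s x).
  move=> x y /=; do 2!case: eqP => //= ; last by move=> _ _ /perm_inj.
    by move=> ? ? E; have := par x; have := par y; congruence.
  by move=> ? ? E; have := par x; have := par y; congruence.
pose rho := perm (can_inj (@swpK k)).
(* [perm (injE true)] moves only even indices; its conjugate by the swap does the same on the odd
   ones. *)
have -> : s = (perm (injE true) * perm (injE true) ^ rho)%g.
  have rV y : (rho^-1)%g y = swp y.
    by apply: (@perm_inj _ rho); rewrite permKV permE swpK.
  have rJ (u : 'S_k.*2) y : (u ^ rho)%g y = rho (u (swp y)).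
    by rewrite -{1}(permKV rho y) permJ rV.
  apply/permP => x; rewrite permM rJ !permE odd_swp; case ox: (odd x) => /=.
    by rewrite ox /= -sw swpK.
  by rewrite par ox /= swpK.
by rewrite odd_permM odd_permJ addbb.
Qed.

Definition Jfun (R : nzRingType) (s : nat -> R) (a b : nat) : R :=
  if ~~ odd a && (b == a.+1) then s a./2
  else if odd a && (a == b.+1) then - s b./2 else 0.

(* The last row and column of [Jmx m s] vanish when [m] is odd. *)
Definition Jmx (R : nzRingType) m (s : nat -> R) : 'M[R]_m :=
  \matrix_(i < m, j < m) Jfun s i j.

Lemma Jmx_skew (R : nzRingType) m (s : nat -> R) : (Jmx m s)^T = - Jmx m s.
Proof.
apply/matrixP => i j; rewrite !mxE /Jfun.
case: ifP => ?; [|case: ifP => ?]; (case: ifP => ?; [|case: ifP => ?]);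
  rewrite ?oppr0 ?opprK //; lia.
Qed.

(** Swapping inside pairs preserves the term, so every pair can be assumed not to be sent to an odd
    index followed by an even one. A nonzero term then comes from a permutation of the pairs, which
    is even. *)
Lemma pfterm_J (R : comNzRingType) k (s : 'S_k.*2) :
  pfterm (Jmx k.*2 (fun=> 1 : R)) s \in [:: 0; 1].
Proof.
pose J := Jmx k.*2 (fun=> 1 : R).
pose X (u : 'S_k.*2) := #|[pred i : 'I_k | odd (u (pr0 i))]|.
(* Induction on the number of pairs whose first element has an odd image. *)
move: {2}(X s).+1 (ltnSn (X s)) => c; elim: c s => // c IH s Xs.
case: (pickP [pred i | odd (s (pr0 i)) && ~~ odd (s (pr1 i))]) => [i /= /andP[oi oi1]|no].
  rewrite -(pfterm_tperm _ i) ?Jmx_skew //; apply: IH.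
  apply: (@leq_trans (X s)) => //; apply: proper_card.
  apply/properP; split.
    apply/fintype.subsetP => j; rewrite !inE permM.
    have [->|ji] := eqVneq j i; first by rewrite tpermL (negbTE oi1).
    by rewrite tpermD // -val_eqE /=; move: ji; rewrite -val_eqE /=; lia.
  by exists i; rewrite !inE ?permM ?tpermL // negbTE.
rewrite /pfterm.
case: (pickP [pred i | J (s (pr0 i)) (s (pr1 i)) == 0]) => [i /eqP /= Ji|nz].
  by rewrite (bigD1 i) //= -/J Ji mul0r mulr0 inE eqxx.
have s0 i : ~~ odd (s (pr0 i)) && (s (pr1 i) == (s (pr0 i)).+1 :> nat).
  have := no i; have := nz i; rewrite /= mxE /Jfun.
  case oa: (odd (s (pr0 i))) => /=; last first.
    by case: (nat_of_ord (s (pr1 i)) == _) => //=; rewrite eqxx.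
  by case: (nat_of_ord (s (pr0 i)) =P _) => [E|_]; rewrite ?eqxx // => _; move: oa; rewrite E /=; case: odd.
rewrite odd_perm_pairs => [||i].
- rewrite expr0 mul1r big1 ?inE ?eqxx ?orbT // => i _.
  by rewrite mxE /Jfun s0.
- by move=> i; case/andP: (s0 i).
- apply: val_inj; case/andP: (s0 i) => /negbTE E /eqP E1.
  by rewrite /swp E /= E1 even_halfK ?E.
Qed.

Lemma pfaffian_Jmx (F : fieldType) k (s : nat -> F) :
  pfaffian (Jmx k.*2 s) = (\prod_(i < k) s i) * pfaffian (Jmx k.*2 (fun=> 1 : F)).
Proof.
(* The scalar [s i] is placed on the even index of the pair [i] only, so that [\det D] is the
   product of the [s i]. *)
pose D : 'M[F]_k.*2 := diag_mx (\row_(x < k.*2) if odd x then 1 else s x./2).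
have -> : Jmx k.*2 s = D^T *m Jmx k.*2 (fun=> 1) *m D.
  rewrite tr_diag_mx mul_diag_mx mul_mx_diag; apply/matrixP => i j.
  rewrite !mxE /Jfun; case oi: (odd i); case oj: (odd j) => /=.
  - have -> : (nat_of_ord i == j.+1) = false by lia.
    by ring.
  - by case: (_ == _.+1); ring.
  - by case: (_ == _.+1); ring.
  - have -> : (nat_of_ord j == i.+1) = false by lia.
    by ring.
rewrite pfaffian_congr det_diag prod_pairs; congr (_ * _).
by apply: eq_bigr => i _; rewrite !mxE /= odd_double /= doubleK mulr1.
Qed.

(** All terms are 0 or 1 and that of the identity is 1, so their sum is a positive integer, nonzero
    in characteristic 0. *)
Lemma pfaffian_J_neq0 (F : fieldType) k :
  [pchar F] =i pred0 -> pfaffian (Jmx k.*2 (fun=> 1 : F)) != 0.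
Proof.
move=> /pcharf0P ch; rewrite pfaffianE mulf_neq0 //.
  by rewrite invr_eq0 ch muln_eq0 expn_eq0 /= -lt0n fact_gt0.
set J := Jmx _ _.
rewrite (eq_bigr (fun s : 'S_k.*2 => (pfterm J s == 1)%:R)); last first.
  by move=> s _; have := pfterm_J F s; rewrite !inE => /orP[] /eqP ->;
     rewrite ?eqxx // eq_sym oner_eq0.
rewrite -natr_sum ch sum_nat_eq0 negb_forall; apply/existsP; exists 1%g.
rewrite /pfterm odd_perm1 expr0 mul1r big1 ?eqxx // => i _.
by rewrite !perm1 mxE /Jfun /= odd_double eqxx /=.
Qed.

(** * Triangular matrices and normal forms of arrows *)

(** Indexing by [nat] with value 0 outside the matrix allows entries of matrices of different sizes
    to be compared without casts. *)
Definition ent (R : nzRingType) m n (A : 'M[R]_(m, n)) (a b : nat) : R :=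
  match insub a, insub b with Some x, Some y => A x y | _, _ => 0 end.

Lemma entE (R : nzRingType) m n (A : 'M[R]_(m, n)) (i : 'I_m) (j : 'I_n) : ent A i j = A i j.
Proof. by rewrite /ent !valK. Qed.

Lemma ent_out (R : nzRingType) m n (A : 'M[R]_(m, n)) a b :
  ~~ ((a < m)%N && (b < n)%N) -> ent A a b = 0.
Proof.
rewrite /ent; case: insubP => // x xm _; case: insubP => // y yn _.
by rewrite xm yn.
Qed.

Lemma ent_mx (R : nzRingType) m n (f : nat -> nat -> R) a b :
  ent (\matrix_(i < m, j < n) f i j) a b = if (a < m)%N && (b < n)%N then f a b else 0.
Proof.
case: ifP => [/andP[am bn]|/negbT/ent_out //].
by rewrite (entE _ (Ordinal am) (Ordinal bn)) mxE.
Qed.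

Lemma ent_addmx (R : nzRingType) m n (A B : 'M[R]_(m, n)) a b :
  ent (A + B) a b = ent A a b + ent B a b.
Proof.
have [/andP[am bn]|o] := boolP ((a < m)%N && (b < n)%N).
  by rewrite !(entE _ (Ordinal am) (Ordinal bn)) mxE.
by rewrite !ent_out // addr0.
Qed.

Lemma ent_scalemx (R : nzRingType) m n (A : 'M[R]_(m, n)) c a b :
  ent (c *: A) a b = c * ent A a b.
Proof.
have [/andP[am bn]|o] := boolP ((a < m)%N && (b < n)%N).
  by rewrite !(entE _ (Ordinal am) (Ordinal bn)) mxE.
by rewrite !ent_out // mulr0.
Qed.

Lemma sum_ord_single (R : nzRingType) m (F : nat -> R) a :
  (forall p, (p < m)%N -> p != a -> F p = 0) ->
  \sum_(p < m) F p = if (a < m)%N then F a else 0.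
Proof.
move=> F0; case: ltnP => am; last first.
  by apply: big1 => p _; apply: F0 => //; have := ltn_ord p; lia.
rewrite (bigD1 (Ordinal am)) //= big1 ?addr0 // => p pa.
by apply: F0.
Qed.

Definition upper (R : nzRingType) q (b : 'M[R]_q) :=
  forall i j : 'I_q, (j < i)%N -> b i j = 0.

(** The product is the leading minor of size [d]: these matrices preserve the coordinate flag, and
    the volume of its member of dimension [d] for each [d] in [D]. *)
Definition Bset (R : comNzRingType) (D : pred nat) q (b : 'M[R]_q) :=
  upper b /\ forall d, D d -> (d <= q)%N -> \prod_(0 <= i < d) ent b i i = 1.

Lemma Bset_det (R : comNzRingType) (D : pred nat) q (b : 'M[R]_q) :
  D q -> Bset D b -> \det b = 1.
Proof.
move=> Dq [ub /(_ q Dq (leqnn q))]; rewrite big_mkord => <-.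
rewrite -det_tr det_trig.
  by apply: eq_bigr => i _; rewrite mxE entE.
by apply/is_trig_mxP => i j ij; rewrite mxE ub.
Qed.

Lemma Bset_unitri (R : comNzRingType) (D : pred nat) q (b : 'M[R]_q) :
  upper b -> (forall i, b i i = 1) -> Bset D b.
Proof.
move=> ub b1; split=> // d _ dq; rewrite big_nat big1 // => i /andP[_ id].
have iq : (i < q)%N by lia.
by rewrite (entE b (Ordinal iq) (Ordinal iq)).
Qed.

Lemma Bset_mul (R : comNzRingType) (D : pred nat) q (b c : 'M[R]_q) :
  Bset D b -> Bset D c -> Bset D (b *m c).
Proof.
move=> [ub db] [uc dc]; split=> [i j ji|d Dd dq].
  rewrite mxE big1 // => l _; case: (ltnP l i) => li; first by rewrite ub ?mul0r.
  by rewrite uc ?mulr0 //; lia.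
transitivity (\prod_(0 <= i < d) (ent b i i * ent c i i)); last first.
  by rewrite big_split /= db // dc // mulr1.
apply: eq_big_nat => i /andP[_ id]; have iq : (i < q)%N by lia.
pose o := Ordinal iq.
rewrite (entE _ o o) (entE b o o) (entE c o o) mxE (bigD1 o) //= big1 ?addr0 // => l lo.
have : (l < o)%N || (o < l)%N by rewrite -neq_ltn.
by case/orP => ?; [rewrite ub ?mul0r|rewrite uc ?mulr0].
Qed.

Definition NFw (R : nzRingType) p q (t : R) (i : nat) : R :=
  if i.+1 == minn p q then t else 1.

Definition NFm (R : nzRingType) p q (t : R) : 'M[R]_(p, q) :=
  \matrix_(i < p, j < q) if i == j :> nat then NFw p q t i else 0.

Lemma NFm_mull (R : nzRingType) p q r (t : R) (M : 'M[R]_(q, r)) i j :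
  (NFm p q t *m M) i j = NFw p q t i * ent M i j.
Proof.
rewrite mxE.
rewrite (eq_bigr (fun l : 'I_q => (fun l : nat =>
  (if (i : nat) == l then NFw p q t i else 0) * ent M l j) (nat_of_ord l))); last first.
  by move=> l _; rewrite mxE entE.
rewrite (@sum_ord_single _ _ (fun l : nat =>
  (if (i : nat) == l then NFw p q t i else 0) * ent M l j) i); last first.
  by move=> l _; rewrite eq_sym => /negbTE ->; rewrite mul0r.
rewrite eqxx; case: ltnP => // iq; rewrite ent_out ?mulr0 //; lia.
Qed.

Lemma NFm_mulr (R : nzRingType) p q r (t : R) (M : 'M[R]_(r, p)) i j :
  (M *m NFm p q t) i j = ent M i j * NFw p q t j.
Proof.
rewrite mxE.
rewrite (eq_bigr (fun l : 'I_p => (fun l : nat =>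
  ent M i l * (if l == (j : nat) then NFw p q t l else 0)) (nat_of_ord l))); last first.
  by move=> l _; rewrite mxE entE.
rewrite (@sum_ord_single _ _ (fun l : nat =>
  ent M i l * (if l == (j : nat) then NFw p q t l else 0)) j); last first.
  by move=> l _ /negbTE ->; rewrite mulr0.
rewrite eqxx; case: ltnP => // iq; rewrite ent_out ?mul0r //; lia.
Qed.

Lemma NFw_neq0 (K : fieldType) p q (t : K) i : t != 0 -> NFw p q t i != 0.
Proof. by rewrite /NFw; case: ifP => // _ _; rewrite oner_neq0. Qed.

(** One step of moving [b] backwards through a normalised arrow. On the common indices [b'] is [b]
    conjugated by the weights of the arrow, which keeps the diagonal; elsewhere it is the identity.
    The set imposed on [b] is the recursion that defines [Dk] below. *)
Lemma Bset_lift (K : fieldType) (D : pred nat) p q (t : K) (b : 'M[K]_p) :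
  t != 0 -> Bset (fun d => D d && (d <= p)%N || (d == p)) b ->
  exists2 b' : 'M[K]_q, Bset D b' & NFm p q t *m b' = b *m NFm p q t.
Proof.
move=> t0 [ub db]; pose w := NFw p q t.
have w0 i : w i != 0 by apply: NFw_neq0.
pose f (i j : nat) :=
  if (i < p)%N && (j < p)%N then ent b i j * w j / w i else (i == j)%:R.
have ub' (i j : nat) : (j < i)%N -> ent b i j = 0.
  move=> ji; have [/andP[ip jp]|] := boolP ((i < p)%N && (j < p)%N).
    by rewrite (entE b (Ordinal ip) (Ordinal jp)) ub.
  exact: ent_out.
exists (\matrix_(i, j) f i j).
  split=> [i j ji|d Dd dq].
    rewrite mxE /f ub' // !mul0r; case: ifP => // _.
    by rewrite (_ : (_ == _) = false) //; lia.
  have E i : (i < d)%N -> ent (\matrix_(i < q, j < q) f i j) i i = if (i < p)%N then ent b i i else 1.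
    move=> id; rewrite ent_mx (leq_trans id dq) /= /f andbb eqxx; case: ifP => // _.
    by rewrite mulfK.
  rewrite (eq_big_nat _ _ (fun i h => E i (proj2 (andP h)))).
  case: (leqP d p) => dp.
    rewrite -[RHS](db d); [|by rewrite Dd dp|by []].
    by apply: eq_big_nat => i /andP[_ id]; rewrite (leq_trans id dp).
  (* For [d > p] the diagonal entries from [p] on are 1, and the product of the first [p] is 1 since
     [p] belongs to the set imposed on [b]. *)
  rewrite (big_cat_nat (n := p)) //=; last exact: ltnW.
  rewrite [X in _ * X]big_nat [X in _ * X]big1 ?mulr1 => [|i /andP[pi _]]; last by rewrite ltnNge pi.
  rewrite -[RHS](db p) ?eqxx ?orbT //.
  by apply: eq_big_nat => i /andP[_ ->].
apply/matrixP => i j; rewrite NFm_mull NFm_mulr -/w ent_mx ltn_ord andbT /f ltn_ord /=.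
case: (ltnP i q) => iq; case: (ltnP j p) => jp.
- by rewrite mulrC divfK.
- rewrite ent_out ?mul0r; last by lia.
  rewrite (_ : (_ == _) = false) ?mulr0 //.
  by have := ltn_ord i; lia.
- by rewrite ub' ?mul0r ?mulr0 //; have := ltn_ord j; lia.
- by have := ltn_ord j; have := ltn_ord i; lia.
Qed.

Definition lead (R : nzRingType) r m n (A : 'M[R]_(m, n)) : 'M[R]_r :=
  \matrix_(i < r, j < r) ent A i j.

Lemma det_NFw (R : comNzRingType) p q (t : R) :
  (minn p q = p) -> (p = 0%N -> t = 1) -> \det (diag_mx (\row_(i < p) NFw p q t i)) = t.
Proof.
move=> Epq p0; rewrite det_diag; case: p Epq p0 => [|p] Epq p0.
  by rewrite big_ord0 p0.
rewrite big_ord_recr /= big1 => [|i _]; rewrite !mxE /NFw Epq ?eqxx ?mul1r //=.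
by rewrite (_ : (_ == _) = false) //; have := ltn_ord i; lia.
Qed.

Lemma lead_lsubmx (R : nzRingType) p e (M : 'M[R]_(p, p + e)) : lead p M = lsubmx M.
Proof. by apply/matrixP => i j; rewrite !mxE -entE. Qed.

Lemma lead_usubmx (R : nzRingType) q e (M : 'M[R]_(q + e, q)) : lead q M = usubmx M.
Proof. by apply/matrixP => i j; rewrite !mxE -entE. Qed.

Lemma lead_ulsubmx (R : nzRingType) q e (M : 'M[R]_(q + e)) : lead q M = ulsubmx M.
Proof. by apply/matrixP => i j; rewrite !mxE -entE. Qed.


Lemma upper_block (R : nzRingType) m n (A : 'M[R]_m) B (D : 'M[R]_n) :
  upper A -> upper D -> upper (block_mx A B 0 D).
Proof.
move=> uA uD i j; case: (split_ordP i) => i' ->; case: (split_ordP j) => j' -> ji.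
- by rewrite block_mxEul uA.
- by exfalso; move: ji; rewrite /=; have := ltn_ord i'; lia.
- by rewrite block_mxEdl mxE.
- by rewrite block_mxEdr uD //; move: ji; rewrite /= ltn_add2l.
Qed.

Lemma upper1 (R : nzRingType) m : upper (1%:M : 'M[R]_m).
Proof.
move=> i j ji; rewrite mxE (_ : (_ == _) = false) //.
by apply/eqP => E; move: ji; rewrite E ltnn.
Qed.

Lemma diag_block (R : nzRingType) m n (A : 'M[R]_m) B C (D : 'M[R]_n) :
  (forall i, A i i = 1) -> (forall i, D i i = 1) -> forall i, block_mx A B C D i i = 1.
Proof.
by move=> A1 D1 i; case: (split_ordP i) => j ->; rewrite (block_mxEul, block_mxEdr).
Qed.

Lemma diag1 (R : nzRingType) m (i : 'I_m) : (1%:M : 'M[R]_m) i i = 1.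
Proof. by rewrite mxE eqxx. Qed.

(** A unipotent [b1] clears the columns beyond [p], and [g] inverts the square block up to its
    determinant [dl], which stays in the last diagonal entry. If [p] is not in [D], a diagonal
    matrix in [Bset D] removes [dl] as well. *)
Lemma SL_normal_wide (K : fieldType) (D : pred nat) p e (M : 'M[K]_(p, p + e)) :
  D (p + e)%N -> \det (lead p M) != 0 ->
  exists t g, exists b : 'M[K]_(p + e), [/\ t != 0, ~~ D p -> t = 1, \det g = 1,
     Bset D b & g *m M *m b = NFm p (p + e) t].
Proof.
rewrite lead_lsubmx => Dq d0; pose M1 := lsubmx M; pose dl := \det M1.
have M1u : M1 \in unitmx by rewrite unitmxE unitfE.
have Epq : minn p (p + e) = p by lia.
have dl0 : (p = 0%N -> dl = 1).
  by rewrite /dl => p0; move: M1 {M1u dl d0 Dq Epq}; clear M; subst p => M1; rewrite det_mx00.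
pose d1 : 'M[K]_p := diag_mx (\row_(i < p) NFw p (p + e) dl i).
pose g := d1 *m invmx M1.
pose b1 : 'M[K]_(p + e) := block_mx 1%:M (- (invmx M1 *m rsubmx M)) 0 1%:M.
have gE : \det g = 1.
  by rewrite det_mulmx det_inv det_NFw // mulfV.
have b1E : Bset D b1.
  apply: Bset_unitri; first by apply: upper_block; apply: upper1.
  by apply: diag_block; apply: diag1.
have MbE : g *m M *m b1 = NFm p (p + e) dl.
  rewrite -mulmxA -{1}(hsubmxK M) mul_row_block !mulmx1 mulmx0 addr0 mulmxN.
  rewrite mulmxA mulmxV // mul1mx addNr mul_mx_row mulmx0 /g -mulmxA mulVmx // mulmx1.
  apply/matrixP => i j; case: (split_ordP j) => j' ->; rewrite ?row_mxEl ?row_mxEr !mxE /=.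
    by rewrite -val_eqE; case: eqP => E; rewrite ?mulr1n ?mulr0n // E.
  by rewrite (_ : (_ == _) = false) //; have := ltn_ord i; lia.
have [Dp|nDp] := boolP (D p); first by exists dl, g, b1.
have [p0|p0] := posnP p; first by exists dl, g, b1; split=> // _; apply: dl0.
have e0 : (0 < e)%N by rewrite lt0n; apply/eqP => e0; move: nDp; rewrite -[p]addn0 -e0 Dq.
(* The entries [dl^-1] and [dl] at positions [p - 1] and [p] alter only the leading minor of size
   [p]. Position [p] exists because [D] contains [p + e] but not [p]. *)
pose x (i : nat) := if i.+1 == p then dl^-1 else if i == p then dl else 1.
have xE d : \prod_(0 <= i < d) x i = if d == p then dl^-1 else 1.
  elim: d => [|d IH]; first by rewrite big_geq // (_ : (_ == _) = false) //; lia.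
  rewrite big_nat_recr //= IH /x; case: (ltngtP d p) => dp.
  - by rewrite mul1r.
  - by rewrite (_ : (_ == _) = false) ?mulr1 //; lia.
  - by rewrite dp (_ : (_ == _) = false) ?mulVf //; lia.
pose f2 (i j : nat) := if i == j then x i else 0.
pose b2 : 'M[K]_(p + e) := \matrix_(i < p + e, j < p + e) f2 i j.
have b2E : Bset D b2.
  split=> [i j ji|d Dd dq].
    by rewrite mxE /f2 (_ : (_ == _) = false) //; lia.
  rewrite (eq_big_nat _ _ (F2 := x)) => [|i /andP[_ id]]; last first.
    by rewrite ent_mx (leq_trans id dq) /= /f2 eqxx.
  by rewrite xE (_ : (_ == _) = false) //; apply/eqP => E; move: nDp; rewrite -E Dd.
exists 1, g, (b1 *m b2); split=> //; first exact: oner_neq0.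
  exact: Bset_mul.
rewrite mulmxA MbE; apply/matrixP => i j.
rewrite NFm_mull ent_mx !mxE ltn_ord /= /f2.
have -> /= : (i < p + e)%N by have := ltn_ord i; lia.
case: eqP => [E|]; rewrite ?mulr0 // /NFw /x Epq; case: (i.+1 =P p) => E'.
  by rewrite mulfV.
by rewrite mul1r (_ : (_ == _) = false) //; have := ltn_ord i; lia.
Qed.

(** The [e > 0] extra rows absorb the determinant: [Y] has determinant [\det M1] and acts on rows
    that become zero. *)
Lemma SL_normal_tall (K : fieldType) q e (M : 'M[K]_(q + e, q)) :
  (0 < e)%N -> \det (lead q M) != 0 ->
  exists2 g, \det g = 1 & g *m M = NFm (q + e) q 1.
Proof.
case: e M => // e M _; rewrite lead_usubmx => d0; pose M1 := usubmx M.
have M1u : M1 \in unitmx by rewrite unitmxE unitfE.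
pose Y : 'M[K]_e.+1 := diag_mx (\row_(i < e.+1) if i == 0 :> nat then \det M1 else 1).
have dY : \det Y = \det M1.
  by rewrite det_diag big_ord_recl /= big1 ?mulr1 ?mxE // => i _; rewrite mxE.
exists (block_mx (invmx M1) 0 (- (Y *m dsubmx M *m invmx M1)) Y).
  by rewrite det_lblock det_inv dY mulVf.
rewrite -[X in _ *m X = _](vsubmxK M) -/M1 mul_block_col mul0mx addr0 mulVmx //.
rewrite mulNmx mulmxKV // addNr; apply/matrixP => i j.
case: (split_ordP i) => i' ->; rewrite ?col_mxEu ?col_mxEd !mxE /= /NFw.
  by rewrite -val_eqE /=; case: eqP => // E; case: ifP.
by rewrite (_ : (_ == _) = false) //; have := ltn_ord j; lia.
Qed.

Lemma SL_normal (K : fieldType) (D : pred nat) p q (M : 'M[K]_(p, q)) :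
  D q -> (forall d, D d -> (d <= q)%N) -> \det (lead (minn p q) M) != 0 ->
  exists t g, exists b : 'M[K]_q, [/\ t != 0, ~~ D p -> t = 1, \det g = 1,
     Bset D b & g *m M *m b = NFm p q t].
Proof.
move=> Dq Dle; case: (leqP p q) => pq.
  by rewrite -(subnKC pq) in M Dq *; apply: SL_normal_wide.
rewrite -(subnKC (ltnW pq)) in M *; move=> d0.
have e0 : (0 < p - q)%N by rewrite subn_gt0.
have [g g1 gM] := SL_normal_tall e0 d0.
exists 1, g, 1%:M; split=> //; first exact: oner_neq0.
  by apply: Bset_unitri; [apply: upper1|apply: diag1].
by rewrite mulmx1.
Qed.

(** * Normal form of a skew form under triangular matrices *)

Lemma skew_block (R : comNzRingType) r e (S : 'M[R]_(r + e)) : S^T = - S ->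
  [/\ (ulsubmx S)^T = - ulsubmx S, (drsubmx S)^T = - drsubmx S
    & dlsubmx S = - (ursubmx S)^T].
Proof.
move=> /matrixP sS; split; apply/matrixP => i j; rewrite !mxE.
- by have := sS (lshift e i) (lshift e j); rewrite !mxE.
- by have := sS (rshift r i) (rshift r j); rewrite !mxE.
- by have := sS (lshift e j) (rshift r i); rewrite !mxE.
Qed.

(** Block Gaussian elimination. The lower left block is [- B^T], so the Schur complement of [A] is
    [D + B^T *m invmx A *m B]. *)
Lemma skew_elim (K : fieldType) r e (S : 'M[K]_(r + e)) (u1 S1' : 'M[K]_r) :
  S^T = - S -> \det (ulsubmx S) != 0 -> upper u1 -> (forall i, u1 i i = 1) ->
  u1^T *m ulsubmx S *m u1 = S1' ->
  exists u : 'M[K]_(r + e), exists T : 'M[K]_e,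
   [/\ upper u, forall i, u i i = 1, T^T = - T & u^T *m S *m u = block_mx S1' 0 0 T].
Proof.
move=> sS d0 uu u1d E; have [sA sD sC] := skew_block sS.
set A := ulsubmx S in d0 E sA *; set B := ursubmx S in sC *; set D := drsubmx S in sD *.
have Au : A \in unitmx by rewrite unitmxE unitfE.
exists (block_mx u1 (- (invmx A *m B)) 0 1%:M).
exists (D + B^T *m invmx A *m B).
have sAi : (invmx A)^T = - invmx A.
  rewrite trmx_inv sA -scaleN1r invmxZ ?invrN1 ?scaleN1r //.
  by rewrite -sA unitmx_tr.
split.
- by apply: upper_block => //; apply: upper1.
- by apply: diag_block => //; apply: diag1.
- by rewrite linearD /= !trmx_mul trmxK sAi sD opprD mulNmx mulmxN mulmxA.
rewrite -[X in _ *m X *m _](submxK S) -/A -/B -/D sC tr_block_mx mulmx_block mulmx_block.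
rewrite !trmx0 !trmx1 !mul0mx !mulmx0 !addr0 !mulmx1 !mul1mx E.
have -> : (- (invmx A *m B))^T = B^T *m invmx A.
  by rewrite linearN /= trmx_mul sAi mulmxN opprK.
rewrite mulmxKV // subrr !mul0mx add0r; congr block_mx; last exact: addrC.
by rewrite mulmxN -mulmxA mulKVmx // addNr.
Qed.

Lemma ent_block (R : nzRingType) r e (A : 'M[R]_r) B C (D : 'M[R]_e) a b :
  ent (block_mx A B C D) a b =
  if (a < r)%N then if (b < r)%N then ent A a b else ent B a (b - r)
  else if (b < r)%N then ent C (a - r) b else ent D (a - r) (b - r).
Proof.
have [/andP[ar br]|o] := boolP ((a < r + e)%N && (b < r + e)%N); last first.
  by rewrite ent_out //; do 2!case: ltnP => ? //; rewrite ent_out //; lia.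
rewrite (entE _ (Ordinal ar) (Ordinal br)).
case: (split_ordP (Ordinal ar)) => i Ei; case: (split_ordP (Ordinal br)) => j Ej;
  rewrite Ei Ej ?block_mxEul ?block_mxEur ?block_mxEdl ?block_mxEdr;
  move/(congr1 val): Ei => /= Ei; move/(congr1 val): Ej => /= Ej; rewrite Ei Ej.
all: by rewrite ?addKn entE.
Qed.

Lemma ent_inj (R : nzRingType) m n (A B : 'M[R]_(m, n)) :
  (forall a b, (a < m)%N -> (b < n)%N -> ent A a b = ent B a b) -> A = B.
Proof. by move=> E; apply/matrixP => i j; rewrite -!entE E. Qed.

Lemma lead_lead (R : nzRingType) r r' m n (A : 'M[R]_(m, n)) :
  (r <= r')%N -> lead r (lead r' A) = lead r A.
Proof.
move=> rr; apply/matrixP => i j; rewrite !mxE ent_mx.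
by have := ltn_ord i; have := ltn_ord j => hj hi; rewrite (leq_trans hi rr) (leq_trans hj rr).
Qed.

Lemma skew_double0 (K : fieldType) m (A : 'M[K]_m) i :
  2%:R != 0 :> K -> A^T = - A -> A i i = 0.
Proof.
move=> two /matrixP /(_ i i); rewrite !mxE => /eqP; rewrite -addr_eq0 -mulr2n -mulr_natl.
by rewrite mulf_eq0 (negbTE two) => /eqP.
Qed.

Lemma det_unitri (R : comNzRingType) q (b : 'M[R]_q) :
  upper b -> (forall i, b i i = 1) -> \det b = 1.
Proof. by move=> ub b1; apply: (@Bset_det R xpredT) => //; apply: Bset_unitri. Qed.

Lemma Jmx_block (R : nzRingType) k e (s : nat -> R) (T : 'M[R]_e) :
  (forall a b, (a < e)%N -> (b < e)%N -> ent T a b = Jfun s (a + k.*2) (b + k.*2)) ->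
  Jmx (k.*2 + e) s = block_mx (Jmx k.*2 s) 0 0 T.
Proof.
move=> TE; apply: ent_inj => a b ae be; rewrite ent_mx ent_block ae be /=.
have E0 m n x y : ent (0 : 'M[R]_(m, n)) x y = 0.
  by rewrite /ent; case: insub => // ?; case: insub => // ?; rewrite mxE.
case: ltnP => ak; case: ltnP => bk; rewrite ?E0.
- by rewrite ent_mx ak bk.
- rewrite /Jfun; case: ifP => [/andP[h /eqP]|_]; first by lia.
  by case: ifP => // /andP[h /eqP]; lia.
- rewrite /Jfun; case: ifP => [/andP[h /eqP]|_]; first by lia.
  by case: ifP => // /andP[h /eqP]; lia.
- by rewrite TE ?subnK //; lia.
Qed.

(** The skew analogue of the LDL decomposition, splitting off one 2 by 2 block at a time. *)
Lemma skew_LDL_even (K : fieldType) k m (S : 'M[K]_m) :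
  2%:R != 0 :> K -> m = k.*2 -> S^T = - S ->
  (forall r, (r.*2 <= m)%N -> \det (lead r.*2 S) != 0) ->
  exists u : 'M[K]_m, exists s : nat -> K,
   [/\ upper u, forall i, u i i = 1, forall r, s r != 0 & u^T *m S *m u = Jmx m s].
Proof.
move=> two; elim: k m S => [|k IH] m S mE.
  move: S; rewrite mE => S _ _; exists 1%:M, (fun=> 1); split=> //; [exact: upper1|exact: diag1|
    by move=> ?; exact: oner_neq0|by apply/matrixP => -[]].
have {}mE : m = (k.*2 + 2)%N by lia.
subst m => sS dS.
have [sA _ _] := skew_block sS.
have [|u1 [s [uu1 u1d s0 E1]]] := IH _ (ulsubmx S) erefl sA.
  move=> r rk; rewrite -lead_ulsubmx lead_lead //; apply: dS; lia.
have d0 : \det (ulsubmx S) != 0 by rewrite -lead_ulsubmx; apply: dS; lia.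
have [u [T [uu ud sT ET]]] := skew_elim sS d0 uu1 u1d E1.
have T0 i : T i i = 0 by apply: skew_double0.
pose c := T ord0 ord_max.
have T10 : T ord_max ord0 = - c.
  by move/matrixP: sT => /(_ ord0 ord_max); rewrite !mxE.
(* If [c] were 0, the whole block [T] would vanish and the full determinant of [S] with it. *)
have c0 : c != 0.
  apply/eqP => c0; have := dS k.+1; rewrite (_ : k.+1.*2 = k.*2 + 2)%N; last by lia.
  rewrite leqnn => /(_ isT).
  have -> : lead (k.*2 + 2) S = S by apply/matrixP => i j; rewrite mxE entE.
  have : \det (u^T *m S *m u) = \det S by rewrite !det_mulmx det_tr det_unitri // mul1r mulr1.
  rewrite ET det_ublock (_ : T = 0) ?det0 ?mulr0 => [<-|]; first by rewrite eqxx.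
  apply/matrixP => i j; rewrite mxE.
  have ord2 (x : 'I_2) : x = ord0 \/ x = ord_max.
    by case: x => [[|[|]]] // h; [left|right]; apply: val_inj.
  by case: (ord2 i) => ->; case: (ord2 j) => ->; rewrite ?T0 // ?T10 -/c c0 ?oppr0.
exists u, (fun i => if i == k then c else s i); split=> //.
  by move=> r; case: ifP.
rewrite ET (@Jmx_block _ k 2 _ T).
  congr block_mx; apply/matrixP => i j; rewrite !mxE /Jfun.
  have -> : ((i : nat)./2 == k) = false by have := ltn_ord i; lia.
  by have -> : ((j : nat)./2 == k) = false by have := ltn_ord j; lia.
move=> a b a2 b2; rewrite (entE T (Ordinal a2) (Ordinal b2)).
have Ej x (h : (x < 2)%N) : Ordinal h = if x == 0%N then ord0 else ord_max.
  by apply: val_inj; case: ifP => /=; lia.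
rewrite !Ej /Jfun; case: a a2 => [|[|]] // _; case: b b2 => [|[|]] // _ /=;
 rewrite ?T0 ?T10 ?add0n ?add1n /= ?odd_double /= ?eqxx ?doubleK ?eqxx //.
- by rewrite (_ : (k.*2 == _) = false) //; lia.
- by rewrite (_ : (k.*2.+1 == _) = false) //; lia.
Qed.

(** In odd size the elimination leaves a 1 by 1 skew block, which is zero, as in the last row of
    [Jmx]. *)
Lemma skew_LDL (K : fieldType) m (S : 'M[K]_m) :
  2%:R != 0 :> K -> S^T = - S ->
  (forall r, (r.*2 <= m)%N -> \det (lead r.*2 S) != 0) ->
  exists u : 'M[K]_m, exists s : nat -> K,
   [/\ upper u, forall i, u i i = 1, forall r, s r != 0 & u^T *m S *m u = Jmx m s].
Proof.
move=> two; case om: (odd m); last by apply: (@skew_LDL_even _ m./2) => //; lia.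
have mE : m = (m./2.*2 + 1)%N by lia.
move: (m./2) mE => k mE; subst m => sS dS.
have [sA _ _] := skew_block sS.
have [|u1 [s [uu1 u1d s0 E1]]] := @skew_LDL_even _ k _ (ulsubmx S) two erefl sA.
  move=> r rk; rewrite -lead_ulsubmx lead_lead //; apply: dS; lia.
have d0 : \det (ulsubmx S) != 0 by rewrite -lead_ulsubmx; apply: dS; lia.
have [u [T [uu ud sT ET]]] := skew_elim sS d0 uu1 u1d E1.
exists u, s; split=> //; rewrite ET (@Jmx_block _ k 1 _ T) // => -[|a] [|b] // h1 h2.
rewrite (entE T (Ordinal h1) (Ordinal h2)).
rewrite (_ : Ordinal h1 = Ordinal h2) ?(skew_double0 _ two) //; last exact: val_inj.
rewrite /Jfun (_ : (_ == _) = false) ?andbF //; lia.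
Qed.

(** [Jmx] would need the quotients of consecutive Pfaffians as entries. Here the prescribed
    Pfaffians [tau] are themselves entries, in row 0, so the section is polynomial in its
    parameters. *)
Definition Bfun (R : nzRingType) (tau : nat -> R) (a b : nat) : R :=
  if (a == 0)%N && odd b then tau b./2 else if odd a && (b == a.+1) then 1 else 0.

Definition Bmx (R : nzRingType) m (tau : nat -> R) : 'M[R]_m :=
  \matrix_(i < m, j < m) Bfun tau i j.

Definition Sgm (R : nzRingType) m (tau : nat -> R) : 'M[R]_m :=
  Bmx m tau - (Bmx m tau)^T.

Lemma alt_skew (R : nzRingType) m (B : 'M[R]_m) : (B - B^T)^T = - (B - B^T).
Proof. by rewrite linearB /= trmxK opprB. Qed.

Definition ptau (R : nzRingType) (tau : nat -> R) (r : nat) : R :=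
  if r is r'.+1 then tau r' else 1.

(* On the odd and even indices [Sgm m tau] is a companion matrix with leading minors [tau r];
   [vfun] interleaves the two factors of its LU decomposition. *)
Definition vfun (K : fieldType) (tau : nat -> K) (p x : nat) : K :=
  if odd x then (if odd p && (p <= x)%N then tau x./2 / tau p./2 else 0)
  else (p == x)%:R - (if ~~ odd p && (p.+2 == x) then ptau tau p./2 / tau p./2 else 0).

Definition vmx (K : fieldType) m (tau : nat -> K) : 'M[K]_m :=
  \matrix_(i < m, j < m) vfun tau i j.

Lemma vmx_upper (K : fieldType) m (tau : nat -> K) : upper (vmx m tau).
Proof.
move=> i j ji; rewrite mxE /vfun; case: ifP => oj.
  by rewrite leqNgt ji andbF.
have -> : (nat_of_ord i == j) = false by lia.
have -> : (i.+2 == j) = false by lia.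
by rewrite andbF subr0.
Qed.

Lemma vmx_diag (K : fieldType) m (tau : nat -> K) i :
  (forall r, tau r != 0) -> vmx m tau i i = 1.
Proof.
move=> t0; rewrite mxE /vfun eqxx leqnn; case oi: (odd i) => /=; first by rewrite mulfV.
have -> : (i.+2 == i) = false by lia.
by rewrite subr0.
Qed.

Lemma Jmx_mull (K : fieldType) m (s : nat -> K) (f : nat -> nat -> K) (i j : 'I_m) :
  (Jmx m s *m (\matrix_(i < m, j < m) f i j)) i j =
  if odd i then - s i./2 * f i.-1 j
  else if (i.+1 < m)%N then s i./2 * f i.+1 j else 0.
Proof.
pose F (l : nat) := Jfun s i l * f l j.
rewrite mxE (eq_bigr (fun l : 'I_m => F l)); last by move=> l _; rewrite !mxE.
case oi: (odd i).
  rewrite (@sum_ord_single _ _ F i.-1) /F.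
    have -> : (i.-1 < m)%N by have := ltn_ord i; lia.
    have E : (nat_of_ord i == i.-1.+1) = true by lia.
    have E2 : i.-1./2 = i./2 by lia.
    by rewrite /Jfun oi /= E E2.
  move=> p pm pi; have E : (nat_of_ord i == p.+1) = false by lia.
  by rewrite /Jfun oi /= E mul0r.
rewrite (@sum_ord_single _ _ F i.+1) /F; first by rewrite /Jfun oi eqxx.
by move=> p pm pi; rewrite /Jfun oi /= (negbTE pi) mul0r.
Qed.

(** Both sides are skew and vanish at positions of equal parity, so it is enough to compare them at
    even rows and odd columns. *)
Lemma Sgm_congr (K : fieldType) m (tau : nat -> K) :
  (forall r, tau r != 0) ->
  (vmx m tau)^T *m Jmx m (fun r => tau r / ptau tau r) *m vmx m tau = Sgm m tau.
Proof.
move=> t0; set s := fun r => _; set v := vmx m tau.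
have pt0 r : ptau tau r != 0 by case: r => [|r] /=; rewrite ?oner_neq0.
set L := _ *m v.
have sL : L^T = - L by rewrite /L act_skewP // Jmx_skew.
have sR : (Sgm m tau)^T = - Sgm m tau by apply: alt_skew.
have LE (x y : 'I_m) : L x y = \sum_(p < m) v p x * (Jmx m s *m v) p y.
  by rewrite /L -mulmxA mxE; apply: eq_bigr => p _; rewrite mxE.
have SE (x y : 'I_m) : Sgm m tau x y = Bfun tau x y - Bfun tau y x by rewrite !mxE.
have Hsame (x y : 'I_m) : odd x = odd y -> L x y = Sgm m tau x y.
  move=> oxy; rewrite LE SE big1 => [|p _]; last first.
    rewrite Jmx_mull mxE /vfun -oxy; case ox: (odd x) => /=.
      case op: (odd p); last by rewrite mul0r.
      have -> : odd p.-1 = false by lia.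
      by rewrite !mulr0.
    case op: (odd p) => /=.
      have -> : (nat_of_ord p == x) = false by lia.
      by rewrite subr0 mul0r.
    have -> : (p.+1 == y) = false by lia.
    by rewrite subr0 mulr0 if_same mulr0.
  rewrite /Bfun oxy; case oy: (odd y) => /=; rewrite ?andbF ?andbT ?subr0 //.
  have -> : (nat_of_ord x == 0)%N = false by lia.
  have -> : (nat_of_ord y == 0)%N = false by lia.
  have -> : (nat_of_ord y == x.+1) = false by lia.
  have -> : (nat_of_ord x == y.+1) = false by lia.
  by rewrite subr0.
have Heo (x y : 'I_m) : ~~ odd x -> odd y -> L x y = Sgm m tau x y.
  move=> /negbTE ox oy; rewrite LE SE.
  pose g (p : nat) := if ~~ odd p && (p <= y)%N then tau y./2 / ptau tau p./2 else 0.
  have gE (p : 'I_m) : ~~ odd p -> (Jmx m s *m v) p y = g p.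
    move=> /negbTE op; rewrite Jmx_mull op /vfun oy /= op /= /g op /=.
    have ym := ltn_ord y.
    case: ltnP => pm; last by rewrite (_ : (p <= y)%N = false) //; lia.
    rewrite (_ : (p < y)%N = (p <= y)%N); last by lia.
    case: ifP => py; last by rewrite mulr0.
    rewrite (_ : uphalf p = p./2) /s; last by rewrite uphalf_half op.
    by rewrite mulrC mulrA divfK.
  pose h1 (p : nat) := (p == x)%:R * g p.
  pose h2 (p : nat) :=
    if ~~ odd p && (p.+2 == x) then ptau tau p./2 / tau p./2 * g p else 0.
  (* An even column [x] of [v] has at most two nonzero entries, at [x] and [x - 2]; their
     contributions cancel except when [x = 0] or [x = y + 1]. *)
  transitivity (\sum_(p < m) (h1 p - h2 p)).
    apply: eq_bigr => p _; rewrite /h1 /h2 mxE /vfun ox; case op: (odd p) => /=.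
      have -> : (nat_of_ord p == x) = false by lia.
      by rewrite subr0 !mul0r subr0.
    by rewrite gE ?op // mulrBl; case: ifP => // _; rewrite mul0r.
  rewrite big_split /= (@sum_ord_single _ _ h1 x); last first.
    by move=> p _ /negbTE px; rewrite /h1 px mul0r.
  (* For [x < 2] the index [x.-2] is 0, where [h2] takes its default value 0. *)
  rewrite ltn_ord {1}/h1 eqxx mul1r sumrN (@sum_ord_single _ _ h2 x.-2); last first.
    by move=> p _ px; rewrite /h2; case: ifP => // /andP[_ /eqP E]; move: px; rewrite -E eqxx.
  have -> : (x.-2 < m)%N by have := ltn_ord x; lia.
  rewrite /h2 /g /Bfun ox oy /= andbT andbF.
  case x0: (nat_of_ord x) => [|x'] /=.
    by rewrite invr1 mulr1.
  case: x' x0 => [|x'] x0; first by move: ox; rewrite x0.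
  have ox' : odd x' = false by move: ox; rewrite x0 /=; case: odd.
  rewrite /= ox' /= eqxx sub0r.
  case: (nat_of_ord y =P x'.+1) => yx.
    rewrite yx ltnn sub0r leqnSn eqxx; congr (- _).
    have -> : x'.+1./2 = x'./2 by lia.
    by field; rewrite t0 pt0.
  have -> : (x'.+2 == y.+1) = false by lia.
  rewrite oppr0.
  rewrite (_ : (x' <= y)%N = (x'.+1 < y)%N); last by lia.
  case: ifP => h; last by rewrite mulr0 subrr.
  by field; rewrite t0 pt0.
apply/matrixP => x y; case ox: (odd x); case oy: (odd y).
- by apply: Hsame; rewrite ox oy.
- have := Heo y x; rewrite ox oy => /(_ isT isT) E.
  have skE (M : 'M[K]_m) : M^T = - M -> M x y = - M y x.
    by move/matrixP => /(_ y x); rewrite !mxE.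
  by rewrite (skE _ sL) (skE _ sR) E.
- by apply: Heo; rewrite ?ox ?oy.
- by apply: Hsame; rewrite ox oy.
Qed.

(** The product telescopes: [X d] is the leading minor of size [d]. *)
Lemma Bset_diag (K : fieldType) (D : pred nat) q (X : nat -> K) :
  (forall d, X d != 0) -> X 0%N = 1 -> (forall d, D d -> X d = 1) ->
  Bset D (diag_mx (\row_(i < q) (X i.+1 / X i))).
Proof.
move=> X0 X01 XD; split=> [i j ji|d Dd dq].
  by rewrite !mxE (_ : (i == j) = false) ?mulr0n //; apply/eqP => E; move: ji; rewrite E ltnn.
rewrite (@eq_big_nat _ _ _ _ _ _ (fun i => X i.+1 / X i)); last first.
  move=> i /andP[_ id]; have iq := leq_trans id dq.
  by rewrite (entE _ (Ordinal iq) (Ordinal iq)) !mxE eqxx mulr1n.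
rewrite -[RHS](XD d Dd) {Dd dq}; elim: d => [|d IH]; first by rewrite big_geq.
by rewrite big_nat_recr //= IH mulrC divfK.
Qed.

Lemma Jmx_scale (K : fieldType) m (s x : nat -> K) :
  (diag_mx (\row_(i < m) x i))^T *m Jmx m s *m diag_mx (\row_(i < m) x i) =
  Jmx m (fun r => s r * x r.*2 * x r.*2.+1).
Proof.
rewrite tr_diag_mx mul_diag_mx mul_mx_diag; apply/matrixP => i j; rewrite !mxE /Jfun.
case: ifP => [/andP[oi /eqP ->]|_].
  by rewrite even_halfK //; ring.
case: ifP => [/andP[oi /eqP E]|_]; last by rewrite mulr0 mul0r.
by rewrite E even_halfK; [ring|move: oi; rewrite E].
Qed.

(** The reduction to some [Jmx m s] is followed by a diagonal scaling, which sets to 1 the leading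
    Pfaffians whose size is not in [D], and by the passage to the companion form. *)
Lemma skew_normal (K : fieldType) (D : pred nat) m (S : 'M[K]_m) :
  2%:R != 0 :> K -> S^T = - S ->
  (forall r, (r.*2 <= m)%N -> \det (lead r.*2 S) != 0) ->
  exists b : 'M[K]_m, exists tau : nat -> K,
   [/\ Bset D b, forall r, tau r != 0, forall r, ~~ D r.*2.+2 -> tau r = 1
     & b^T *m S *m b = Sgm m tau].
Proof.
move=> two sS dS; have [u [s [uu ud s0 Eu]]] := skew_LDL two sS dS.
pose P (d : nat) := \prod_(0 <= i < d) s i.
have P0 d : P d != 0.
  rewrite /P; elim: d => [|d IH]; first by rewrite big_geq // oner_neq0.
  by rewrite big_nat_recr //= mulf_neq0.
(* [X d] prescribes the leading minors of the scaling, and [P d] is the leading Pfaffian of size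
   [2d] up to a constant. Outside [D] the minor at an even size is the inverse of [P], which makes
   [tau] equal to 1 there. *)
pose X (d : nat) := if D d || odd d then 1 else (P d./2)^-1.
have X0 d : X d != 0 by rewrite /X; case: ifP; rewrite ?oner_neq0 // invr_eq0 P0.
have X00 : X 0%N = 1 by rewrite /X /P /= big_geq // invr1 if_same.
pose tau (r : nat) := P r.+1 * X r.*2.+2.
have tau0 r : tau r != 0 by rewrite mulf_neq0.
pose x := diag_mx (\row_(i < m) (X i.+1 / X i)).
exists (u *m x *m vmx m tau), tau; split=> //.
- apply: Bset_mul; last by apply: Bset_unitri; [exact: vmx_upper|move=> i; exact: vmx_diag].
  apply: Bset_mul; first exact: Bset_unitri.
  by apply: Bset_diag => // d Dd; rewrite /X Dd.
- move=> r /negbTE nD; rewrite /tau /X nD /= odd_double /= doubleK.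
  by rewrite mulfV.
rewrite !trmx_mul -!mulmxA (mulmxA S) (mulmxA u^T) (mulmxA u^T) Eu.
rewrite -(Sgm_congr m tau0) -!mulmxA; congr (_ *m _); rewrite !mulmxA; congr (_ *m _).
rewrite (Jmx_scale m s (fun i => X i.+1 / X i)).
apply/matrixP => i j; rewrite !mxE /Jfun.
have E r : s r * (X r.*2.+1 / X r.*2) * (X r.*2.+2 / X r.*2.+1) = tau r / ptau tau r.
  have PS : P r.+1 = P r * s r by rewrite /P big_nat_recr.
  have -> : ptau tau r = P r * X r.*2.
    by case: r {PS} => [|r] //=; rewrite X00 mulr1 /P big_geq.
  by rewrite /tau PS; field; rewrite !X0 P0.
by rewrite !E.
Qed.

(** * Polynomial functions and invariance of the generators *)

(** Evaluates the dependent conditionals in [arr] and [gat] at any given proof of the bound. *)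
Lemma convoyT (T : Type) (b : bool) (f : b = true -> T) (x : T) (h : b = true) :
  (if b as b' return b = b' -> T then f else fun=> x) (erefl b) = f h.
Proof. by case: b f h => // f h; congr f; apply: eq_irrelevance. Qed.

Lemma convoyF (T : Type) (b : bool) (f : b = true -> T) (x : T) :
  b = false -> (if b as b' return b = b' -> T then f else fun=> x) (erefl b) = x.
Proof. by case: b f. Qed.

Lemma gatE (K : fieldType) n alpha (g : forall k : 'I_n, 'M[K]_(alpha k.+1)) v
  (h : (v < n)%N) : gat g v.+1 = g (Ordinal h).
Proof. exact: (@convoyT 'M[K]_(alpha v.+1) _ (fun h => g (Ordinal h)) 1%:M h). Qed.

Lemma arrE (K : fieldType) n alpha (V : orep K n alpha) v (h : (v < n.-1)%N) :
  arr V v.+1 = Defs.omap V (Ordinal h).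
Proof. exact: (@convoyT 'M[K]_(alpha v.+2, alpha v.+1) _ (fun h => Defs.omap V (Ordinal h)) 0 h). Qed.

Lemma arr_out (K : fieldType) n alpha (V : orep K n alpha) v :
  (v < n.-1)%N = false -> arr V v.+1 = 0.
Proof. exact: (@convoyF 'M[K]_(alpha v.+2, alpha v.+1) _ (fun h => Defs.omap V (Ordinal h)) 0). Qed.

(** A polynomial function sees only the coordinates, so representations with different skewness
    proofs can be exchanged. *)
Lemma polyfun_ext (K : fieldType) n alpha (f : orep K n alpha -> K) : polyfun f ->
  forall V W, (forall k, Defs.omap V k = Defs.omap W k) -> oskew V = oskew W -> f V = f W.
Proof.
elim=> {f} [c|k r c|r c|f g _ IHf _ IHg|f g _ IHf _ IHg|f g _ IHf E] V W EM ES //.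
- by rewrite EM.
- by rewrite ES.
- by rewrite (IHf V W) // (IHg V W).
- by rewrite (IHf V W) // (IHg V W).
- by rewrite -!E; apply: IHf.
Qed.

Lemma polyfun_sum (K : fieldType) n alpha (I : Type) (r : seq I) (P : pred I)
  (f : I -> orep K n alpha -> K) :
  (forall i, P i -> polyfun (f i)) -> polyfun (fun V => \sum_(i <- r | P i) f i V).
Proof.
move=> pf; elim: r => [|i r IH].
  by apply: (pf_ext (pf_const _ _ 0)) => V; rewrite big_nil.
case Pi: (P i); last by apply: (pf_ext IH) => V; rewrite big_cons Pi.
by apply: (pf_ext (pf_add (pf i Pi) IH)) => V; rewrite big_cons Pi.
Qed.

Lemma polyfun_prod (K : fieldType) n alpha (I : Type) (r : seq I) (P : pred I)
  (f : I -> orep K n alpha -> K) :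
  (forall i, P i -> polyfun (f i)) -> polyfun (fun V => \prod_(i <- r | P i) f i V).
Proof.
move=> pf; elim: r => [|i r IH].
  by apply: (pf_ext (pf_const _ _ 1)) => V; rewrite big_nil.
case Pi: (P i); last by apply: (pf_ext IH) => V; rewrite big_cons Pi.
by apply: (pf_ext (pf_mul (pf i Pi) IH)) => V; rewrite big_cons Pi.
Qed.

Definition polymx (K : fieldType) n alpha p q (M : orep K n alpha -> 'M[K]_(p, q)) :=
  forall i j, polyfun (fun V => M V i j).

Lemma polymx_mul (K : fieldType) n alpha p q r
  (M : orep K n alpha -> 'M[K]_(p, q)) (M' : orep K n alpha -> 'M[K]_(q, r)) :
  polymx M -> polymx M' -> polymx (fun V => M V *m M' V).
Proof.
move=> pM pM' i j.
apply: (@pf_ext _ _ _ (fun V => \sum_k M V i k * M' V k j)); last by move=> V; rewrite mxE.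
by apply: polyfun_sum => k _; apply: pf_mul.
Qed.

Lemma polymx_ext (K : fieldType) n alpha p q (M M' : orep K n alpha -> 'M[K]_(p, q)) :
  polymx M -> (forall V, M V = M' V) -> polymx M'.
Proof. by move=> pM E i j; apply: (pf_ext (pM i j)) => V; rewrite E. Qed.

Lemma polymx_cast (K : fieldType) n alpha p q p' q' (e : (p = p') * (q = q'))
  (M : orep K n alpha -> 'M[K]_(p, q)) : polymx M -> polymx (fun V => castmx e (M V)).
Proof. by move=> pM i j; apply: (pf_ext (pM _ _)) => V; rewrite castmxE. Qed.

Lemma polymx0 (K : fieldType) n alpha p q : polymx (fun _ : orep K n alpha => 0 : 'M[K]_(p, q)).
Proof. by move=> i j; apply: (pf_ext (pf_const _ _ 0)) => V; rewrite mxE. Qed.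

Lemma polymx_tr (K : fieldType) n alpha p q (M : orep K n alpha -> 'M[K]_(p, q)) :
  polymx M -> polymx (fun V => (M V)^T).
Proof. by move=> pM i j; apply: (pf_ext (pM j i)) => V; rewrite mxE. Qed.

Lemma polymx_scale (K : fieldType) n alpha p q c (M : orep K n alpha -> 'M[K]_(p, q)) :
  polymx M -> polymx (fun V => c *: M V).
Proof.
move=> pM i j; apply: (pf_ext (pf_mul (pf_const _ _ c) (pM i j))) => V; by rewrite mxE.
Qed.

Lemma polymx_oskew (K : fieldType) n alpha : polymx (@oskew K n alpha).
Proof. by move=> i j; apply: pf_coord_skew. Qed.

Lemma polymx_arr (K : fieldType) n alpha k : polymx (fun V : orep K n alpha => arr V k).
Proof.
case: k => [|k]; first exact: polymx0.
case h: (k < n.-1)%N; last first.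
  by apply: (@polymx_ext _ _ _ _ _ (fun=> 0)) => [|V]; [apply: polymx0|rewrite arr_out].
apply: (@polymx_ext _ _ _ _ _ (fun V => Defs.omap V (Ordinal h))) => [|V]; last by rewrite (arrE V h).
by move=> i j; apply: pf_coord_map.
Qed.

Lemma polymx_chain (K : fieldType) n alpha j d :
  polymx (fun V : orep K n alpha => chain V j d).
Proof.
elim: d => [|d IH] /=; first exact: polymx_arr.
by apply: polymx_mul => //; apply: polymx_arr.
Qed.

Lemma polymx_skew_comp (K : fieldType) n alpha i :
  polymx (fun V : orep K n alpha => skew_comp V i).
Proof.
rewrite /skew_comp; case: eqP => e.
  apply: polymx_scale; apply: polymx_mul; last by apply: polymx_cast; apply: polymx_chain.
  apply: polymx_mul; last exact: polymx_oskew.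
  by apply: polymx_tr; apply: polymx_cast; apply: polymx_chain.
by case: eqP => e'; [apply: polymx_cast; apply: polymx_oskew|apply: polymx0].
Qed.

Lemma polyfun_det (K : fieldType) n alpha p (M : orep K n alpha -> 'M[K]_p) :
  polymx M -> polyfun (fun V => \det (M V)).
Proof.
move=> pM; apply: polyfun_sum => s _; apply: pf_mul; first exact: pf_const.
by apply: polyfun_prod => i _.
Qed.

Lemma polyfun_rdet (K : fieldType) n alpha p q (M : orep K n alpha -> 'M[K]_(p, q)) :
  polymx M -> polyfun (fun V => rdet (M V)).
Proof.
move=> pM; rewrite /rdet; case: eqP => e; last exact: pf_const.
by apply: polyfun_det; apply: polymx_cast.
Qed.

Lemma polyfun_pfaffian (K : fieldType) n alpha p (M : orep K n alpha -> 'M[K]_p) :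
  polymx M -> polyfun (fun V => pfaffian (M V)).
Proof.
move=> pM; rewrite /pfaffian; case: (odd p); first exact: pf_const.
apply: pf_mul; first exact: pf_const.
apply: polyfun_sum => s _; apply: pf_mul; first exact: pf_const.
apply: polyfun_prod => i _; rewrite /mxat.
case: (insub (permat s i.*2)) => [x|]; last exact: pf_const.
case: (insub (permat s i.*2.+1)) => [y|]; [exact: pM|exact: pf_const].
Qed.

Lemma gat_det (K : fieldType) n alpha (g : forall k : 'I_n, 'M[K]_(alpha k.+1)) v :
  SOelt g -> \det (gat g v) = 1.
Proof.
move=> gS; case: v => [|v]; first by rewrite det1.
case h: (v < n)%N; first by rewrite (gatE g h); exact (gS (Ordinal h)).
by rewrite [gat g _](@convoyF 'M[K]_(alpha v.+1) _ (fun h => g (Ordinal h)) 1%:M) ?det1.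
Qed.

Lemma gat_unit (K : fieldType) n alpha (g : forall k : 'I_n, 'M[K]_(alpha k.+1)) v :
  SOelt g -> gat g v \in unitmx.
Proof. by move=> gS; rewrite unitmxE gat_det ?unitr1. Qed.

Lemma arr_oact (K : fieldType) n alpha (g : forall k : 'I_n, 'M[K]_(alpha k.+1))
  (V : orep K n alpha) k :
  arr (oact g V) k = gat g k.+1 *m arr V k *m invmx (gat g k).
Proof.
case: k => [|k]; first by rewrite /arr mulmx0 mul0mx.
case h: (k < n.-1)%N; last by rewrite !arr_out // mulmx0 mul0mx.
by rewrite !(arrE _ h).
Qed.

Lemma chain_oact (K : fieldType) n alpha (g : forall k : 'I_n, 'M[K]_(alpha k.+1))
  (V : orep K n alpha) j d : SOelt g ->
  chain (oact g V) j d = gat g (d + j).+1 *m chain V j d *m invmx (gat g j).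
Proof.
move=> gS; elim: d => [|d IH]; first exact: arr_oact.
have E W : chain W j d.+1 = arr W (d.+1 + j) *m chain W j d by [].
rewrite !E IH arr_oact -!mulmxA; congr (_ *m (_ *m _)).
by rewrite !mulmxA mulVmx ?gat_unit // mul1mx.
Qed.

Lemma rdet_mul (R : comNzRingType) m n (X : 'M[R]_m) (A : 'M[R]_(m, n)) (Y : 'M[R]_n) :
  rdet (X *m A *m Y) = \det X * rdet A * \det Y.
Proof.
rewrite /rdet; case: eqP => [e|_]; last by rewrite mulr0 mul0r.
by subst n; rewrite !castmx_id !det_mulmx.
Qed.

Lemma cast_gat (K : fieldType) n alpha (g : forall k : 'I_n, 'M[K]_(alpha k.+1))
  m q (e : n = m) (X : 'M[K]_(alpha m, q)) (Y : 'M[K]_q) :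
  castmx (congr1 alpha (esym e), erefl) (gat g m *m X *m Y) =
  gat g n *m castmx (congr1 alpha (esym e), erefl) X *m Y.
Proof. by subst m; rewrite /= !castmx_id. Qed.

Lemma skew_comp_oact (K : fieldType) n alpha (g : forall k : 'I_n, 'M[K]_(alpha k.+1))
  (V : orep K n alpha) i : SOelt g ->
  skew_comp (oact g V) i =
  (invmx (gat g i))^T *m skew_comp V i *m invmx (gat g i).
Proof.
move=> gS; rewrite /skew_comp; case: eqP => e.
  rewrite /= chain_oact // cast_gat -scalemxAr -scalemxAl; congr (_ *: _).
  set C := castmx _ _; rewrite !trmx_mul !mulmxA; congr (_ *m _).
  rewrite mulmxKV ?gat_unit //; congr (_ *m _ *m _).
  by rewrite -!mulmxA -trmx_mul mulVmx ?gat_unit // trmx1 mulmx1.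
case: eqP => e'; last by rewrite mulmx0 mul0mx.
by move: e'; clear e => e'; subst i; rewrite /= !castmx_id.
Qed.

Lemma gens_OSI (K : fieldType) n alpha (f : orep K n alpha -> K) : OSI_gens f -> in_OSI f.
Proof.
case=> [[i [j [_ _ _ _ ->]]]|[i [_ _ _ _ ->]]]; split.
- by apply: polyfun_rdet; apply: polymx_chain.
- move=> g gS V; rewrite chain_oact // rdet_mul det_inv !gat_det //.
  by rewrite invr1 mul1r mulr1.
- by apply: polyfun_pfaffian; apply: polymx_skew_comp.
- move=> g gS V; rewrite skew_comp_oact // pfaffian_congr det_inv gat_det //.
  by rewrite invr1 mul1r.
Qed.

Lemma gen_alg_OSI (K : fieldType) n alpha (f : orep K n alpha -> K) :
  gen_alg (@OSI_gens K n alpha) f -> in_OSI f.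
Proof.
elim=> {f} [c|f /gens_OSI//|f g _ [pf If] _ [pg Ig]|f g _ [pf If] _ [pg Ig]|f g _ [pf If] E].
- by split=> //; exact: pf_const.
- by split=> [|h hS V]; [exact: pf_add|rewrite If ?Ig].
- by split=> [|h hS V]; [exact: pf_mul|rewrite If ?Ig].
- by split=> [|h hS V]; [exact: pf_ext pf E|rewrite -!E If].
Qed.

(** * Vanishing of invariants on the generic section *)

Lemma poly_all_roots (K : fieldType) (p : {poly K}) :
  [pchar K] =i pred0 -> (forall x, p.[x] = 0) -> p = 0.
Proof.
move=> /pcharf0P ch p0; apply/eqP; apply: contraT => pn0.
have := max_poly_roots pn0 (rs := [seq i%:R | i <- iota 0 (size p)]).
rewrite size_map size_iota ltnn => /(_ _ _) -> //.
  by apply/allP => x _; rewrite /root p0.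
rewrite map_inj_in_uniq ?iota_uniq // => i j _ _.
wlog: i j / (i <= j)%N => [H|ij]; first by case/orP: (leq_total i j) => /H // H' /esym/H'/esym.
move/eqP; rewrite eq_sym -subr_eq0 -natrB // ch subn_eq0 => ji.
by apply/eqP; rewrite eqn_leq ij.
Qed.

(** The point 1 of the line is generic and 0 is the point of interest: [p * d] vanishes everywhere,
    hence as a polynomial, and [d] is nonzero. *)
Lemma poly_generic0 (K : fieldType) (p d : {poly K}) :
  [pchar K] =i pred0 -> d.[1] != 0 -> (forall s, d.[s] != 0 -> p.[s] = 0) -> p.[0] = 0.
Proof.
move=> ch d1 H; have : p * d = 0.
  apply: poly_all_roots => // x; rewrite hornerM.
  by have [->|/H->] := eqVneq d.[x] 0; rewrite ?mulr0 ?mul0r.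
move/eqP; rewrite mulf_eq0 => /orP[/eqP->|/eqP d0]; first by rewrite horner0.
by move: d1; rewrite d0 horner0 eqxx.
Qed.

Lemma det_line (K : fieldType) r (A B : 'M[K]_r) :
  exists d : {poly K}, forall s, d.[s] = \det (A + s *: B).
Proof.
exists (\det (\matrix_(i, j) ((A i j)%:P + B i j *: 'X))) => s.
rewrite -[LHS]/(horner_eval s _) -det_map_mx; congr (\det _).
by apply/matrixP => i j; rewrite !mxE /= /horner_eval !hornerE mulrC.
Qed.

Lemma lead_line (K : fieldType) r m n (A B : 'M[K]_(m, n)) s :
  lead r (A + s *: B) = lead r A + s *: lead r B.
Proof. by apply/matrixP => i j; rewrite !mxE ent_addmx ent_scalemx. Qed.

(** The point of the line is any [U] with the right coordinates, so no sum of representations has to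
    be built. *)
Lemma polyfun_line (K : fieldType) n alpha (F : orep K n alpha -> K) (V W : orep K n alpha) :
  polyfun F -> exists p : {poly K}, forall s U,
   (forall k, Defs.omap U k = Defs.omap V k + s *: Defs.omap W k) ->
   oskew U = oskew V + s *: oskew W -> F U = p.[s].
Proof.
elim=> {F} [c|k r c|r c|f g _ [p IHp] _ [q IHq]|f g _ [p IHp] _ [q IHq]|f g _ [p IHp] E].
- by exists c%:P => s U _ _; rewrite hornerC.
- exists ((Defs.omap V k r c)%:P + Defs.omap W k r c *: 'X) => s U EM _.
  by rewrite EM !mxE !hornerE mulrC.
- exists ((oskew V r c)%:P + oskew W r c *: 'X) => s U _ ES.
  by rewrite ES !mxE !hornerE mulrC.
- by exists (p + q) => s U EM ES; rewrite hornerD (IHp s U) // (IHq s U).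
- by exists (p * q) => s U EM ES; rewrite hornerM (IHp s U) // (IHq s U).
- by exists p => s U EM ES; rewrite -E; apply: IHp.
Qed.

Lemma det_Jmx_neq0 (K : fieldType) k : \det (Jmx k.*2 (fun=> 1 : K)) != 0.
Proof.
set J := Jmx _ _.
have JJ : J *m J = - 1%:M.
  apply/matrixP => i j; rewrite /J {2}/Jmx Jmx_mull !mxE -val_eqE /= /Jfun.
  have := ltn_ord i; case oi: (odd i) => ik.
    have -> : odd i.-1 = false by lia.
    rewrite mulN1r /=; congr (- _).
    have -> : (nat_of_ord j == i.-1.+1) = (nat_of_ord i == j) by lia.
    by case: eqP.
  have -> : (i.+1 < k.*2)%N by lia.
  rewrite /= oi /= mul1r eqSS; by case: eqP; rewrite ?oppr0.
apply/eqP => d0; have := congr1 determinant JJ.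
rewrite det_mulmx d0 mul0r => /esym/eqP; apply/negP.
by rewrite -scaleN1r detZ det1 mulr1 expf_neq0 // oppr_eq0 oner_neq0.
Qed.

Lemma lead_Jmx (R : nzRingType) r m (s : nat -> R) :
  (r <= m)%N -> lead r (Jmx m s) = Jmx r s.
Proof.
move=> rm; apply/matrixP => i j; rewrite !mxE ent_mx.
by rewrite !(leq_trans (ltn_ord _) rm).
Qed.

Lemma lead_NFm (R : nzRingType) p q : lead (minn p q) (NFm p q (1 : R)) = 1%:M.
Proof.
apply/matrixP => i j; rewrite !mxE.
rewrite (@ent_mx _ _ _ (fun i j : nat => if i == j then NFw p q 1 i else 0)).
have := ltn_ord i; have := ltn_ord j; rewrite !leq_min => /andP[_ ->] /andP[-> _] /=.
by rewrite -val_eqE /NFw if_same; case: eqP.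
Qed.

(* The values [alpha j.+1], [j <= k], such that no later vertex up to [k.+1] has smaller
   dimension: the flags of [K^(alpha k.+1)] whose volume is fixed by the normalised arrows. *)
Fixpoint Dk (alpha : nat -> nat) (k : nat) : pred nat :=
  match k with
  | 0 => pred1 (alpha 1%N)
  | k'.+1 => fun d => Dk alpha k' d && (d <= alpha k'.+2)%N || (d == alpha k'.+2)
  end.

Lemma Dk_last alpha k : Dk alpha k (alpha k.+1).
Proof. by case: k => [|k] /=; rewrite eqxx ?orbT. Qed.

Lemma Dk_le alpha k d : Dk alpha k d -> (d <= alpha k.+1)%N.
Proof. by case: k => [|k] /=; [move/eqP->|case/orP => [/andP[]|/eqP ->]]. Qed.

(* Skew forms are written [B - B^T], so that both arguments of [mkrep] range over vector
   spaces and no skewness proof has to be transported. *)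
Definition mkrep (K : fieldType) N alpha (A : forall k, 'M[K]_(alpha k.+2, alpha k.+1))
  (B : 'M[K]_(alpha N.+1)) : orep K N.+1 alpha :=
  @ORep K N.+1 alpha (fun k : 'I_N => A k) (B - B^T) (alt_skew B).

(** The parameter ranges of the section: [t l] is a free nonzero scalar when a determinant in (i)
    ends at the arrow from vertex [l.+1] to [l.+2], and 1 otherwise. *)
Definition good_t (K : fieldType) alpha (t : nat -> K) :=
  forall l, t l != 0 /\ (~~ Dk alpha l (alpha l.+2) -> t l = 1).

Definition normal_upto (K : fieldType) alpha k (t : nat -> K)
  (A : forall k, 'M[K]_(alpha k.+2, alpha k.+1)) :=
  forall l, (l < k)%N -> A l = NFm (alpha l.+2) (alpha l.+1) (t l).

Definition upd (K : fieldType) alpha (h : forall l, 'M[K]_(alpha l.+1)) k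
  (b : 'M[K]_(alpha k.+1)) : forall l, 'M[K]_(alpha l.+1) :=
  @dfwith nat (fun l => 'M[K]_(alpha l.+1)) h k b.

Lemma upd_in (K : fieldType) alpha (h : forall l, 'M[K]_(alpha l.+1)) k b :
  @upd K alpha h k b k = b.
Proof. exact: (@dfwith_in nat (fun l => 'M[K]_(alpha l.+1))). Qed.

Lemma upd_out (K : fieldType) alpha (h : forall l, 'M[K]_(alpha l.+1)) k b l :
  k != l -> @upd K alpha h k b l = h l.
Proof. exact: (@dfwith_out nat (fun l => 'M[K]_(alpha l.+1))). Qed.

(** Lifting [b] from vertex [k.+1] back to vertex 1, one normalised arrow at a time, gives a group
    element that fixes all these arrows. *)
Lemma Bset_lift_all (K : fieldType) alpha k (t : nat -> K)
  (A : forall k, 'M[K]_(alpha k.+2, alpha k.+1)) (b : 'M[K]_(alpha k.+1)) :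
  good_t alpha t -> normal_upto k t A -> Bset (Dk alpha k) b ->
  exists h : forall l, 'M[K]_(alpha l.+1), [/\ h k = b,
    forall l, (l <= k)%N -> \det (h l) = 1 &
    forall l, (l < k)%N -> A l *m h l = h l.+1 *m A l].
Proof.
move=> gt; elim: k b => [|k IH] b nA Bb.
  exists (@upd _ _ (fun l => 1%:M) 0 b); split=> [|l|//]; first by rewrite upd_in.
  by rewrite leqn0 => /eqP ->; rewrite upd_in; apply: Bset_det Bb; apply: Dk_last.
have [b' Bb' E] := @Bset_lift K (Dk alpha k) _ (alpha k.+1) (t k) b (proj1 (gt k)) Bb.
have [|h [hk hd hE]] := IH b' _ Bb'; first by move=> l lk; apply: nA; lia.
have hout l : (l <= k)%N -> @upd _ _ h k.+1 b l = h l.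
  by move=> lk; rewrite upd_out //; apply/eqP => ?; lia.
exists (@upd _ _ h k.+1 b); split=> [|l|l lk]; first by rewrite upd_in.
  rewrite leq_eqVlt => /orP[/eqP->|lk]; last by rewrite hout // hd.
  by rewrite upd_in; apply: Bset_det Bb; apply: Dk_last.
move: lk; rewrite ltnS leq_eqVlt => /orP[/eqP->|lk]; last by rewrite !hout // ?hE //; lia.
by rewrite upd_in hout // hk nA.
Qed.

(** The group element is the family of inverses of [h], so the form is changed by the congruence
    with [h N] itself. *)
Lemma mkrep_act (K : fieldType) N alpha (F : orep K N.+1 alpha -> K) A B
  (h : forall l, 'M[K]_(alpha l.+1)) :
  in_OSI F -> (forall l, (l <= N)%N -> \det (h l) = 1) ->
  F (mkrep A B) =
  F (mkrep (fun l => invmx (h l.+1) *m A l *m h l) ((h N)^T *m B *m h N)).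
Proof.
move=> [pF IF] hd; pose g (k : 'I_N.+1) := invmx (h k).
have gS : SOelt g by move=> k; rewrite /g det_inv hd ?invr1 // -ltnS.
have gE l : (l <= N)%N -> gat g l.+1 = invmx (h l) by move=> lN; rewrite (gatE g lN).
rewrite -(IF g gS); apply: (polyfun_ext pF) => [k|].
  have kN : (k < N)%N := ltn_ord k.
  rewrite -[LHS]/(gat g k.+2 *m A k *m invmx (gat g k.+1)).
  by rewrite (gE k.+1) // (gE k) ?invmxK // ltnW.
rewrite -[LHS]/((invmx (gat g N.+1))^T *m (B - B^T) *m invmx (gat g N.+1)).
rewrite gE // invmxK mulmxBr mulmxBl [RHS]/=; congr (_ - _).
by rewrite !trmx_mul trmxK mulmxA.
Qed.

Section Density.
Variables (K : fieldType) (N : nat) (alpha : nat -> nat) (F : orep K N.+1 alpha -> K).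
Hypotheses (hK : [pchar K] =i pred0) (OF : in_OSI F).
Hypothesis F0 : forall t tau, good_t alpha t -> (forall r, tau r != 0) ->
  (forall r, ~~ Dk alpha N r.*2.+2 -> tau r = 1) ->
  F (mkrep (fun l => NFm (alpha l.+2) (alpha l.+1) (t l)) (Bmx (alpha N.+1) tau)) = 0.

Let two : 2%:R != 0 :> K.
Proof. by rewrite (pcharf0P _).1. Qed.

Let half : 2%:R^-1 + 2%:R^-1 = 1 :> K.
Proof. by field. Qed.

(** Removal of genericity: [s = 0] is the given representation, and [d] is the genericity condition,
    satisfied at [s = 1]. *)
Let line A A' B B' (d : {poly K}) :
  d.[1] != 0 ->
  (forall s, d.[s] != 0 -> F (mkrep (fun l => A l + s *: A' l) (B + s *: B')) = 0) ->
  F (mkrep A B) = 0.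
Proof.
move=> d1 H; have [p pE] := polyfun_line (mkrep A B) (mkrep A' B') (proj1 OF).
have E s : F (mkrep (fun l => A l + s *: A' l) (B + s *: B')) = p.[s].
  apply: pE => //; rewrite /= linearD /= linearZ /= scalerBr.
  by rewrite opprD addrACA.
have := poly_generic0 hK d1 (fun s ds => etrans (esym (E s)) (H s ds)).
rewrite -E => <-; apply: (polyfun_ext (proj1 OF)) => [k|] /=; first by rewrite scale0r addr0.
by rewrite scale0r addr0.
Qed.

(** All arrows are normal and only the form is arbitrary. It is joined by a line to the standard
    form, and generic points of the line are brought to the section by [skew_normal]. *)
Let vanish_top A B t : good_t alpha t -> normal_upto N t A -> F (mkrep A B) = 0.
Proof.
move=> gt nA; set m := alpha N.+1 in B *.
pose B0 : 'M[K]_m := 2%:R^-1 *: Jmx m (fun=> 1).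
have B0E : B0 - B0^T = Jmx m (fun=> 1).
  rewrite /B0 linearZ /= Jmx_skew scalerN opprK -scalerDl half.
  by rewrite scale1r.
(* The genericity condition is the product of all leading minors of even size. *)
have [d dE] : exists d : {poly K}, forall s, d.[s] = \prod_(r < m./2.+1)
   \det (lead r.*2 (B - B^T + s *: (B0 - B0^T - (B - B^T)))).
  elim: (m./2.+1) => [|r [d dE]]; first by exists 1 => s; rewrite big_ord0 hornerC.
  have [e eE] := det_line (lead r.*2 (B - B^T)) (lead r.*2 (B0 - B0^T - (B - B^T))).
  by exists (d * e) => s; rewrite big_ord_recr hornerM dE eE /= lead_line.
apply: (@line A (fun=> 0) B (B0 - B) d) => [|s].
  rewrite dE scale1r addrC subrK B0E; apply/prodf_neq0 => r _.
  rewrite lead_Jmx ?det_Jmx_neq0 //; have := ltn_ord r; lia.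
rewrite dE => /prodf_neq0 ds.
set Bs := B + s *: (B0 - B).
have BsE : Bs - Bs^T = B - B^T + s *: (B0 - B0^T - (B - B^T)).
  by rewrite /Bs linearD /= linearZ /= linearB /=; apply/matrixP => i j; rewrite !mxE; ring.
have [r|b [tau [Bb t0 tD bE]]] := @skew_normal K (Dk alpha N) m (Bs - Bs^T) two (alt_skew _).
  move=> rm; rewrite BsE; have rh : (r < m./2.+1)%N by lia.
  exact: (ds (Ordinal rh)).
(* The change of basis [b] at the last vertex extends to the other vertices without disturbing the
   arrows. *)
have [h [hN hd hE]] := Bset_lift_all gt nA Bb.
rewrite (mkrep_act _ _ OF hd) -[RHS](F0 gt t0 tD).
apply: (polyfun_ext (proj1 OF)) => [k|].
  rewrite /= scaler0 addr0 -mulmxA hE ?mulKmx ?nA //; try exact: (ltn_ord k).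
  by rewrite unitmxE hd ?unitr1 //; apply: (ltn_ord k).
rewrite /= hN -/m; transitivity (b^T *m (Bs - Bs^T) *m b); last by rewrite bE.
by rewrite mulmxBr mulmxBl !trmx_mul trmxK mulmxA.
Qed.

(** One more arrow is normalised: [g] acts at its target, and [b] at its source extends to the left
    while fixing the arrows already treated. *)
Let vanish_step k : (k < N)%N ->
  (forall A B t, good_t alpha t -> normal_upto k.+1 t A -> F (mkrep A B) = 0) ->
  forall A B t, good_t alpha t -> normal_upto k t A -> F (mkrep A B) = 0.
Proof.
move=> kN IH A B t gt nA.
pose p := alpha k.+2; pose q := alpha k.+1.
(* Only arrow [k] moves along the line, towards its normal form with parameter 1. *)
pose A' l := if l == k then NFm (alpha l.+2) (alpha l.+1) 1 - A l else 0.
have [d dE] := det_line (lead (minn p q) (A k)) (lead (minn p q) (NFm p q 1 - A k)).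
apply: (@line A A' B 0 d) => [|s].
  by rewrite dE -lead_line scale1r addrC subrK lead_NFm det1 oner_neq0.
rewrite dE -lead_line; set M := A k + _ => ds.
have [tk [g [b [tk0 tkD g1 Bb gE]]]] :=
  SL_normal (Dk_last alpha k) (@Dk_le alpha k) ds.
set As := fun l => _.
have AsE l : (l < k)%N -> As l = A l.
  by move=> lk; rewrite /As /A' (_ : (l == k) = false) ?scaler0 ?addr0 //; lia.
have nAs : normal_upto k t As by move=> l lk; rewrite AsE // nA.
have [h [hk hd hE]] := Bset_lift_all gt nAs Bb.
(* [invmx g] is placed at the target of arrow [k] and the identity beyond it; the next arrow is
   altered, but it is still arbitrary. *)
pose h' := @upd K alpha (fun l => if (l <= k)%N then h l else 1%:M) k.+1 (invmx g).
have h'E l : (l <= k)%N -> h' l = h l.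
  by move=> lk; rewrite /h' upd_out ?lk //; lia.
have h'k : h' k.+1 = invmx g by rewrite /h' upd_in.
have h'd l : (l <= N)%N -> \det (h' l) = 1.
  case: (leqP l k) => lk _; first by rewrite h'E ?hd.
  have [->|lk'] := eqVneq l k.+1; first by rewrite h'k det_inv g1 invr1.
  by rewrite /h' upd_out 1?eq_sym // leqNgt lk /= det1.
rewrite (mkrep_act _ _ OF h'd).
apply: (IH _ _ (fun l => if l == k then tk else t l)) => [l|l].
  by case: (l =P k) => [->|_]; [split|exact: (gt l)].
rewrite ltnS leq_eqVlt => /orP[/eqP->|lk].
  rewrite eqxx h'k h'E // hk invmxK -gE; congr (_ *m _ *m _).
  by rewrite /M /As /A' eqxx.
rewrite (_ : (l == k) = false); last by lia.
rewrite !h'E //; last exact: ltnW.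
rewrite -mulmxA hE // mulKmx ?nAs //.
by rewrite unitmxE hd ?unitr1.
Qed.

Lemma OSI_vanish V : F V = 0.
Proof.
(* Here [k] counts the arrows that are not yet normalised. *)
have H k : (k <= N)%N -> forall A B t, good_t alpha t -> normal_upto (N - k) t A -> F (mkrep A B) = 0.
  elim: k => [|k IH] kN A B t; first by rewrite subn0; apply: vanish_top.
  apply: vanish_step; first by lia.
  by rewrite (_ : (N - k.+1).+1 = N - k)%N; [apply: IH; lia|lia].
have g1 : good_t alpha (fun=> 1 : K) by move=> l; split=> //; apply: oner_neq0.
have n0 : normal_upto (N - N) (fun=> 1 : K) (fun k => arr V k.+1).
  by move=> l; rewrite subnn.
(* A skew form [S] is [B - B^T] for [B] equal to half of [S]. *)
rewrite -(H N (leqnn N) _ (2%:R^-1 *: oskew V) _ g1 n0).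
apply: (polyfun_ext (proj1 OF)) => [k|].
  by case: k => i hi; rewrite -[RHS]/(arr V i.+1) (arrE V hi).
rewrite /= linearZ /= oskewP scalerN opprK -scalerDl half.
by rewrite scale1r.
Qed.

End Density.

(** * Values of the generators on the section *)

Lemma pfaffian_scale (F : fieldType) m k c (A : 'M[F]_m) :
  m = k.*2 -> pfaffian (c *: A) = c ^+ k * pfaffian A.
Proof.
move=> mE; move: A; rewrite mE => A; rewrite !pfaffianE mulrCA; congr (_ * _).
rewrite big_distrr /=; apply: eq_bigr => s _; rewrite /pfterm mulrCA; congr (_ * _).
under eq_bigr do rewrite mxE.
by rewrite big_split /= prodr_const card_ord.
Qed.

(** The Pfaffian of the congruent [Jmx] is a telescoping product of the quotients
    [tau i / ptau tau i]. *)
Lemma pfaffian_Sgm (F : fieldType) m r (tau : nat -> F) :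
  m = r.+1.*2 -> (forall i, tau i != 0) ->
  pfaffian (Sgm m tau) = tau r * pfaffian (Jmx r.+1.*2 (fun=> 1 : F)).
Proof.
move=> -> t0; rewrite -Sgm_congr // pfaffian_congr det_unitri; last 2 first.
- exact: vmx_upper.
- by move=> i; apply: vmx_diag.
rewrite mul1r pfaffian_Jmx; congr (_ * _).
elim: r => [|r IH]; first by rewrite big_ord_recl big_ord0 mulr1 /= divr1.
by rewrite big_ord_recr /= IH mulrC divfK.
Qed.

Fixpoint lastj (alpha : nat -> nat) (k d : nat) : nat :=
  if alpha k.+1 == d then k else if k is k'.+1 then lastj alpha k' d else 0%N.

(** [Dk] gives the weak inequalities after [j], and the choice of the last such vertex makes them
    strict, as (i) and (ii) require. *)
Lemma lastjP alpha k d : Dk alpha k d ->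
  [/\ (lastj alpha k d <= k)%N, alpha (lastj alpha k d).+1 = d &
      forall l, (lastj alpha k d < l)%N -> (l <= k)%N -> (d < alpha l.+1)%N].
Proof.
elim: k => [|k IH] /=.
  by move=> /eqP ->; rewrite eqxx; split=> // l; lia.
case: (alpha k.+2 =P d) => [E _|ne]; first by split=> // l; lia.
rewrite orbC (_ : (d == _) = false) /=; last by apply/eqP => E; apply: ne.
case/andP => /IH [jk aj jl] dk; split=> [||l lj]; [by lia|by []|].
rewrite leq_eqVlt => /orP[/eqP->|lk]; last exact: jl.
by rewrite ltn_neqAle dk andbT; apply/eqP => E; apply: ne.
Qed.

Lemma rdet_diag (R : comNzRingType) p q (M : 'M[R]_(p, q)) (w : nat -> R) :
  p = q -> (forall r c, M r c = if r == c :> nat then w r else 0) ->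
  rdet M = \det (diag_mx (\row_(i < p) w i)).
Proof.
move=> e ME; rewrite /rdet; case: eqP => // e'; clear e; subst q.
rewrite castmx_id; congr (\det _); apply/matrixP => i j; rewrite !mxE ME -val_eqE.
by case: eqP.
Qed.

Section Values.
Variables (K : fieldType) (N : nat) (alpha : nat -> nat) (t tau : nat -> K).
Hypothesis gt : good_t alpha t.
Let V : orep K N.+1 alpha :=
  mkrep (fun l => NFm (alpha l.+2) (alpha l.+1) (t l)) (Bmx (alpha N.+1) tau).

Lemma arr_phi v : (v < N)%N -> arr V v.+1 = NFm (alpha v.+2) (alpha v.+1) (t v).
Proof. by move=> vN; rewrite (@arrE K N.+1 alpha V v vN). Qed.

(** A product of partial identities in which only the weight of the last arrow can survive. *)
Lemma chain_phi j d : (d + j < N)%N ->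
  (forall l, (j < l)%N -> (l <= d + j)%N -> (alpha j.+1 < alpha l.+1)%N) ->
  forall r c, chain V j.+1 d r c = if r == c :> nat
    then NFw (alpha (d + j.+1)%N.+1) (alpha (d + j.+1)%N) (t (d + j)%N) r else 0.
Proof.
elim: d => [|d IH] dN al r c.
  by rewrite [chain _ _ _](arr_phi dN) mxE.
have dN' : (d + j.+1 < N)%N by lia.
have E : chain V j.+1 d.+1 = arr V (d + j.+1)%N.+1 *m chain V j.+1 d by [].
have aq : (alpha j.+1 < alpha (d + j.+1)%N.+1)%N by apply: al; lia.
rewrite E arr_phi // NFm_mull.
have -> : ent (chain V j.+1 d) r c = (r == c :> nat)%:R; last first.
  case: (nat_of_ord r =P c) => _; rewrite ?mulr1 ?mulr0 //.
  by congr (NFw _ _ (t _) _); rewrite addSnnS.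
have cj := ltn_ord c.
have [rq|rq] := ltnP r (alpha (d + j.+1)%N.+1); last first.
  rewrite ent_out; last by lia.
  by have -> : (nat_of_ord r == c) = false by lia.
rewrite (entE _ (Ordinal rq) c) IH; [|by lia|by move=> l jl ld; apply: al; lia].
case: (_ =P _) => //= rc; rewrite /NFw; case: eqP => // E1.
(* The weight of an inner arrow sits beyond the columns of the chain if the dimension does not grow
   there; if it grows, [Dk_le] forces the parameter to be 1. *)
case: (leqP (alpha (d + j.+1)%N.+1) (alpha (d + j.+1)%N)) => [h|h].
  by exfalso; move: E1; rewrite rc (minn_idPl h); lia.
move: E1; rewrite (minn_idPr (ltnW h)) rc => E1.
have [_ ->//] := gt (d + j)%N.
by apply/negP => /Dk_le; rewrite addnS in h; rewrite leqNgt h.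
Qed.

Lemma det_phi k d : (k < N)%N -> Dk alpha k (alpha k.+2) -> (0 < alpha k.+2)%N ->
  (d + lastj alpha k (alpha k.+2))%N = k ->
  rdet (chain V (lastj alpha k (alpha k.+2)).+1 d) = t k.
Proof.
move=> kN Dkk a0; have [jk aj jl] := lastjP Dkk; set j := lastj _ _ _ in jk aj jl * => djk.
have E1 : (d + j.+1)%N = k.+1 by rewrite addnS djk.
have ap : alpha (d + j.+1)%N.+1 = alpha k.+2 by rewrite E1.
have aq : (alpha k.+2 <= alpha (d + j.+1)%N)%N.
  rewrite E1; case: (ltngtP j k) jk => // [jk|jk] _; first by apply/ltnW/jl.
  by rewrite -aj jk.
rewrite (rdet_diag (w := NFw (alpha (d + j.+1)%N.+1) (alpha (d + j.+1)%N) (t (d + j)%N))).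
- rewrite det_NFw; first by rewrite djk.
    by apply/minn_idPl; rewrite ap.
  by rewrite ap => a00; rewrite a00 in a0.
- by rewrite ap aj.
- apply: chain_phi; first by rewrite djk.
  by move=> l jl' lk; rewrite aj; apply: jl; rewrite // -djk.
Qed.

(** The composite arrow [C] is a plain partial identity, so the congruence cuts out a leading block
    of [Sgm], again of the form [Sgm]. *)
Lemma skew_comp_phi i : (i <= N)%N ->
  (forall l, (i < l)%N -> (l <= N)%N -> (alpha i.+1 < alpha l.+1)%N) ->
  skew_comp V i.+1 = (-1) ^+ (N.+1 - i.+1) *: Sgm (alpha i.+1) tau.
Proof.
(* At the last vertex the truncated subtraction makes the first test of [skew_comp] fail, and the
   composite is the form itself. *)
move=> iN al; rewrite /skew_comp; case: eqP => e; last first.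
  have E : i = N by lia.
  case: eqP => e'; last by lia.
  move: e'; rewrite {e al iN}E => e'; rewrite castmx_id subnn expr0 scale1r.
  by [].
have iN' : (i < N)%N by lia.
congr (_ *: _); set C := castmx _ _.
have CE : C = NFm (alpha N.+1) (alpha i.+1) 1.
  apply/matrixP => r c; rewrite castmxE /= cast_ord_id chain_phi /=; last 2 first.
  - by lia.
  - by move=> l il lN; apply: al; lia.
  rewrite mxE; case: eqP => // rc; rewrite {2}/NFw if_same /NFw; case: eqP => // E1.
  move: E1; rewrite (_ : (N.+1 - i.+1 - 1 + i.+1 = N)%N); last by lia.
  have aN := al N iN' (leqnn N).
  have cj := ltn_ord c.
  case: (leqP (alpha N.+1) (alpha N)) => [h|h].
    by rewrite rc => E1; exfalso; lia.
  rewrite rc => E1.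
  rewrite (_ : (N.+1 - i.+1 - 1 + i = N.-1)%N); last by lia.
  have [_ ->//] := gt N.-1.
  apply/negP => /Dk_le; rewrite (_ : N.-1.+2 = N.+1); last by lia.
  by rewrite prednK; lia.
have CT : C^T = NFm (alpha i.+1) (alpha N.+1) 1.
  by apply/matrixP => r c; rewrite CE !mxE eq_sym /NFw !if_same.
have aiN : (alpha i.+1 < alpha N.+1)%N by apply: al.
rewrite CT CE; apply/matrixP => r c; rewrite NFm_mulr /NFw if_same mulr1.
have cN : (c < alpha N.+1)%N by exact: ltn_trans (ltn_ord c) aiN.
have rN : (r < alpha N.+1)%N by exact: ltn_trans (ltn_ord r) aiN.
rewrite (entE _ r (Ordinal cN)) NFm_mull /NFw if_same mul1r.
by rewrite (entE _ (Ordinal rN) (Ordinal cN)) !mxE.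
Qed.

End Values.

(** * Generators as coordinates on the section, and the generation theorem *)

Section Coordinates.
Variables (K : fieldType) (N : nat) (alpha : nat -> nat).

(* If [alpha k.+2 = 0] the [k]-th arrow is an empty matrix and carries no coordinate. *)
Definition coord_t (V : orep K N.+1 alpha) (k : nat) : K :=
  if [&& (k < N)%N, Dk alpha k (alpha k.+2) & (0 < alpha k.+2)%N]
  then rdet (chain V (lastj alpha k (alpha k.+2)).+1 (k.+1 - (lastj alpha k (alpha k.+2)).+1))
  else 1.

(** The constant cancels the sign in [skew_comp] and the Pfaffian of the standard form, so that the
    value on the section is exactly [tau r]. *)
Definition coord_tau (V : orep K N.+1 alpha) (r : nat) : K :=
  if Dk alpha N r.*2.+2 then
    ((-1) ^+ (N.+1 - (lastj alpha N r.*2.+2).+1) ^+ r.+1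
      * pfaffian (Jmx r.+1.*2 (fun=> 1 : K)))^-1
    * pfaffian (skew_comp V (lastj alpha N r.*2.+2).+1)
  else 1.

Definition phi (t tau : nat -> K) : orep K N.+1 alpha :=
  mkrep (fun l => NFm (alpha l.+2) (alpha l.+1) (t l)) (Bmx (alpha N.+1) tau).

Lemma coord_t_gen k : gen_alg (@OSI_gens K N.+1 alpha) (fun V => coord_t V k).
Proof.
rewrite /coord_t; case: and3P => [[kN Dkk a0]|_]; last exact: alg_const.
have [jk aj jl] := lastjP Dkk.
apply: alg_gen; left; exists k.+1, (lastj alpha k (alpha k.+2)).+1; split=> //.
by case=> // l jl' lk; rewrite aj; apply: jl.
Qed.

Lemma coord_tau_gen r : gen_alg (@OSI_gens K N.+1 alpha) (fun V => coord_tau V r).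
Proof.
rewrite /coord_tau; case: (boolP (Dk alpha N r.*2.+2)) => [Dr|_]; last exact: alg_const.
have [jk aj jl] := lastjP Dr.
apply: alg_mul; first exact: alg_const.
apply: alg_gen; right; exists (lastj alpha N r.*2.+2).+1; split=> //.
  by case=> // l jl' lk; rewrite aj; apply: jl.
by rewrite aj /= odd_double.
Qed.

(** The coordinates of the section are constants or, up to sign, single parameters, so substituting
    generators stays in the algebra. *)
Lemma phi_gen f : polyfun f ->
  gen_alg (@OSI_gens K N.+1 alpha) (fun V => f (phi (coord_t V) (coord_tau V))).
Proof.
have B a b : gen_alg (@OSI_gens K N.+1 alpha) (fun V => Bfun (coord_tau V) a b).
  rewrite /Bfun; case: (_ && _); first exact: coord_tau_gen.
  by case: (_ && _); exact: alg_const.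
elim=> {f} [c|k r c|r c|f g _ IHf _ IHg|f g _ IHf _ IHg|f g _ IHf E].
- exact: alg_const.
- apply: (@alg_ext _ _ _ (fun V => if r == c :> nat
     then NFw (alpha k.+2) (alpha k.+1) (coord_t V k) r else 0)); last first.
    by move=> V; rewrite /= mxE.
  case: (_ == _); last exact: alg_const.
  by rewrite /NFw; case: (_ == _); [exact: coord_t_gen|exact: alg_const].
- apply: (@alg_ext _ _ _ (fun V => Bfun (coord_tau V) r c + (-1) * Bfun (coord_tau V) c r)).
    by apply: alg_add => //; apply: alg_mul => //; exact: alg_const.
  by move=> V; rewrite /= !mxE mulN1r.
- exact: alg_add.
- exact: alg_mul.
- by apply: (alg_ext IHf) => V; apply: E.
Qed.

Hypothesis hK : [pchar K] =i pred0.

(** Arrows are compared instead of parameters, since an empty arrow does not determine its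
    parameter. *)
Lemma coord_t_phi t tau k : good_t alpha t -> (k < N)%N ->
  NFm (alpha k.+2) (alpha k.+1) (coord_t (phi t tau) k) = NFm (alpha k.+2) (alpha k.+1) (t k).
Proof.
move=> gt kN; rewrite /coord_t kN; case: (posnP (alpha k.+2)) => a0.
  by apply/matrixP => -[i hi]; exfalso; rewrite a0 in hi.
case: (boolP (Dk alpha k (alpha k.+2))) => /= Dkk; last by rewrite (proj2 (gt k) Dkk).
have [jk aj jl] := lastjP Dkk.
by rewrite det_phi // subSS subnK.
Qed.

Lemma coord_tau_phi t tau r : good_t alpha t -> (forall r, tau r != 0) ->
  (forall r, ~~ Dk alpha N r.*2.+2 -> tau r = 1) ->
  coord_tau (phi t tau) r = tau r.
Proof.
move=> gt t0 tD; rewrite /coord_tau; case: ifP => [Dr|/negbT/tD//].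
have [jk aj jl] := lastjP Dr.
rewrite skew_comp_phi //; last by move=> l; rewrite aj; apply: jl.
rewrite (pfaffian_scale _ _ (k := r.+1)) ?aj // (pfaffian_Sgm (r := r)) ?aj //.
rewrite [tau r * _]mulrC [X in _ * X = _]mulrA mulKf //.
by rewrite mulf_neq0 ?pfaffian_J_neq0 // !expf_neq0 // oppr_eq0 oner_neq0.
Qed.

(** The function [h] lies in the algebra of the generators, and [f - h] is an invariant that
    vanishes on the section, hence everywhere. *)
Lemma OSI_generated f : in_OSI f -> gen_alg (@OSI_gens K N.+1 alpha) f.
Proof.
move=> [pf If]; pose h V := f (phi (coord_t V) (coord_tau V)).
have gh : gen_alg (@OSI_gens K N.+1 alpha) h by apply: phi_gen.
have [ph Ih] := gen_alg_OSI gh.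
apply: (alg_ext gh) => V; apply/eqP; rewrite eq_sym -subr_eq0; apply/eqP.
apply: (@OSI_vanish K N alpha (fun V => f V - h V)) => //.
  split=> [|g gS W]; last by rewrite If // Ih.
  apply: (pf_ext (pf_add pf (pf_mul (pf_const _ _ (-1)) ph))) => W.
  by rewrite mulN1r.
move=> t tau gt t0 tD; apply/eqP; rewrite subr_eq0; apply/eqP.
apply: (polyfun_ext pf) => [k|].
  exact/esym/coord_t_phi.
by apply/matrixP => i j; rewrite /= !mxE /Bfun !coord_tau_phi.
Qed.

End Coordinates.

Theorem theorem2p5 (K : closedFieldType) (hK : [pchar K] =i pred0)
  (n : nat) (alpha : nat -> nat) (hn : (1 <= n)%N) :
  (forall f : orep K n alpha -> K, OSI_gens f -> in_OSI f) /\
  (forall f : orep K n alpha -> K, in_OSI f -> gen_alg (@OSI_gens K n alpha) f).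
Proof.
split=> f; first exact: gens_OSI.
by case: n hn f => // N _ f; apply: OSI_generated.
Qed.
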